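(* Let $W\neq\{0\}$ be a strictly convex complex Banach space and take an admissible sequence $w\in\ell_N$ for some $N\ge2$. Given $0<s<s_0\le1$, there exists a continuous $N$-homogeneous polynomial $Q:d_*(w,1)\to W$ that cannot be approximated in the $\|\cdot\|_{s_0}$-norm (nor, in particular, in the $\|\cdot\|$-norm) by elements of $\mathcal{A}_u(d_*(w,1);W)$ that attain the $\|\cdot\|_s$-norm.
   Context: All Banach spaces are complex. An admissible sequence is a decreasing (i.e. nonincreasing) sequence $w=(w_i)_{i\in\mathbb{N}}$ of nonnegative reals with $w_1=1$, $\lim_iw_i=0$, $\sum_iw_i=\infty$. Put $W(n)=\sum_{i=1}^nw_i$. $d_*(w,1)$ (the predual of the Lorentz sequence space $d(w,1)$) is the Banach space of all bounded complex sequences $x=(x(i))_i$ with $\lim_{n\to\infty}\frac{\sum_{i=1}^nx^*(i)}{W(n)}=0$, where $x^*=(x^*(i))_i$ is the decreasing rearrangement of $(|x(i)|)_i$, with norm $\|x\|_W=\sup_n\frac{\sum_{i=1}^nx^*(i)}{W(n)}$. For Banach spaces $X,Y$, $\mathcal{A}_u(X;Y)$ is the space of functions $f:B_X\to Y$ that are uniformly continuous on the closed unit ball $B_X$ and holomorphic on the open unit ball, with norm $\|f\|=\sup_{x\in B_X}\|f(x)\|$. For $0<s\le1$, $\|f\|_s=\sup\{\|f(x)\|:\|x\|\le s\}$; $f$ attains the $\|\cdot\|_s$-norm if $\|f(x_0)\|=\|f\|_s$ for some $x_0\in sB_X$. Polynomials are regarded as elements of $\mathcal{A}_u$ by restriction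 to $B_X$. *)

(* Defs.v *)
From HB Require Import structures.
From mathcomp Require Import all_boot all_order all_algebra.
From mathcomp Require Import all_classical all_reals all_analysis.
From mathcomp.real_closed Require Import complex.

Set Implicit Arguments.
Unset Strict Implicit.
Unset Printing Implicit Defensive.

Import Order.TTheory GRing.Theory Num.Theory.
Import numFieldNormedType.Exports.

Local Open Scope classical_set_scope.
Local Open Scope ring_scope.
Local Open Scope complex_scope.
Local Open Scope card_scope.

(* In a normed space over R[i] the library norm `|v| is an element of R[i]
   (real and nonnegative); rnorm v is the same number as an element of R, so
   that suprema of norms can be taken. *)
Definition rnorm (R : realType) (V : normedZmodType R[i]) (v : V) : R :=
  complex.Re `|v|.

(* Sequences are indexed from 0: w i stands for $w_{i+1}$, so that
   W(n) = \sum_(i < n) w i and the condition $w_1 = 1$ reads w 0 = 1. *)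
Record admissible_seq (R : realType) := AdmissibleSeq {
  admissible_fun :> nat -> R ;
  admissible_ge0 : forall i, 0 <= admissible_fun i ;
  admissible_nonincr : forall i j, (i <= j)%N ->
    admissible_fun j <= admissible_fun i ;
  admissible_w1 : admissible_fun 0 = 1 ;
  admissible_cvg0 : admissible_fun @ \oo --> 0 ;
  admissible_sum : series admissible_fun @ \oo --> +oo }.

Definition Wsum (R : realType) (w : nat -> R) (n : nat) : R :=
  \sum_(i < n) w i.

(* Decreasing rearrangement, through the distribution function: with indices
   from 0, $x^*(i) = \inf \{ t \ge 0 : \#\{k : |x(k)| > t\} \le i \}$. *)
Definition rearr (R : realType) (x : nat -> R[i]) (i : nat) : R :=
  inf [set t : R | 0 <= t /\ [set k | t < rnorm (x k)] #<= `I_i].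

Definition rearr_sum (R : realType) (x : nat -> R[i]) (n : nat) : R :=
  \sum_(i < n) rearr x i.

Definition bounded_seq (R : realType) (x : nat -> R[i]) : Prop :=
  exists M : R, forall k, rnorm (x k) <= M.

Section RNorm.
Context {R : realType}.

Lemma rnormE (U : normedZmodType R[i]) (v : U) : (rnorm v)%:C = `|v|.
Proof. by apply/RRe_real/ger0_real/normr_ge0. Qed.

Lemma rnorm_ge0 (U : normedZmodType R[i]) (v : U) : 0 <= rnorm v.
Proof. by rewrite -lecR rnormE normr_ge0. Qed.

Lemma rnorm0 (U : normedZmodType R[i]) : rnorm (0 : U) = 0.
Proof. by rewrite /rnorm normr0. Qed.

Lemma rnormD (U : normedZmodType R[i]) (u v : U) :
  rnorm (u + v) <= rnorm u + rnorm v.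
Proof. by rewrite -lecR rmorphD /= !rnormE ler_normD. Qed.

Lemma rnormM (a b : R[i]) : rnorm (a * b) = rnorm a * rnorm b.
Proof. by apply: (@complexI R); rewrite rmorphM /= !rnormE normrM. Qed.

Lemma rnorm_eq0 (U : normedZmodType R[i]) (v : U) : rnorm v = 0 -> v = 0.
Proof. by move=> v0; apply/normr0_eq0; rewrite -rnormE v0. Qed.

End RNorm.

Section Rearrangement.
Context {R : realType}.
Implicit Types x y : nat -> R[i].

Let D x i := [set t : R | 0 <= t /\ [set k | t < rnorm (x k)] #<= `I_i].

Lemma rearr_lb x i : lbound (D x i) 0.
Proof. by move=> t []. Qed.

Lemma rearr_nonempty x i : bounded_seq x -> D x i !=set0.
Proof.
move=> [M xM]; exists M; split; first exact: le_trans (rnorm_ge0 _) (xM 0%N).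
rewrite (_ : [set _ | _] = set0) ?card_ge0 //.
by rewrite -subset0 => k /=; rewrite ltNge xM.
Qed.

Lemma rearr_has_inf x i : bounded_seq x -> has_inf (D x i).
Proof.
by move=> bx; split; [exact: rearr_nonempty|exists 0; exact: rearr_lb].
Qed.

Lemma rearr_ge0 x i : bounded_seq x -> 0 <= rearr x i.
Proof.
by move=> bx; apply: lb_le_inf; [exact: rearr_nonempty|exact: rearr_lb].
Qed.

Lemma rearr_sum_ge0 x n : bounded_seq x -> 0 <= rearr_sum x n.
Proof. by move=> bx; apply: sumr_ge0 => i _; exact: rearr_ge0. Qed.

Lemma card_set_seq (s : seq nat) : uniq s -> [set` s] #= `I_(size s).
Proof.
move=> us; rewrite (_ : [set` s] = nth 0%N s @` `I_(size s)).
  apply: inj_card_eq => i j /set_mem /= si /set_mem /= sj /eqP.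
  by rewrite nth_uniq // => /eqP.
apply/seteqP; split=> [k /= ks|_ [i /= si <-]]; last exact: mem_nth.
by exists (index k s); rewrite /= ?index_mem ?nth_index.
Qed.

Lemma card_seq_gt (s : seq nat) (A : set nat) i : uniq s ->
  (forall k, k \in s -> A k) -> A #<= `I_i -> (size s <= i)%N.
Proof.
move=> us sA Ai; rewrite -card_le_II.
apply: (card_le_trans _ Ai).
apply: (@card_le_trans _ _ _ [set` s]); last exact: subset_card_le.
by have := card_set_seq us; rewrite card_eq_le => /andP[].
Qed.

Lemma rearr_ge_last x (s : seq nat) a n : bounded_seq x -> uniq s ->
  size s = n.+1 -> (forall k, k \in s -> rnorm (x a) <= rnorm (x k)) ->
  rnorm (x a) <= rearr x n.
Proof.
move=> bx us sn ha; apply: lb_le_inf; first exact: rearr_nonempty.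
move=> t [t0 ct]; rewrite leNgt; apply/negP => ta.
suff : (size s <= n)%N by rewrite sn ltnn.
apply: card_seq_gt us _ ct => k ks /=.
exact: lt_le_trans ta (ha _ ks).
Qed.

Lemma seq_argmin (f : nat -> R) (s : seq nat) : s != [::] ->
  exists2 a, a \in s & forall k, k \in s -> f a <= f k.
Proof.
elim: s => // b s IH _; have [->|s0] := eqVneq s [::].
  by exists b; rewrite ?mem_head // => k; rewrite inE => /eqP ->.
have [a as_ ha] := IH s0; have [ab|ba] := leP (f a) (f b).
  exists a; first by rewrite inE as_ orbT.
  by move=> k; rewrite inE => /predU1P[->|/ha].
exists b; first by rewrite mem_head.
move=> k; rewrite inE => /predU1P[->|kb]; first exact: lexx.
exact: le_trans (ltW ba) (ha _ kb).
Qed.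

Lemma sum_le_rearr x (s : seq nat) : bounded_seq x -> uniq s ->
  \sum_(k <- s) rnorm (x k) <= rearr_sum x (size s).
Proof.
move=> bx; move sn: (size s) => n; elim: n s sn => [|n IH] s sn us.
  by move/size0nil: sn => ->; rewrite big_nil rearr_sum_ge0.
have s0 : s != [::] by rewrite -size_eq0 sn.
have [a as_ ha] := seq_argmin (fun k => rnorm (x k)) s0.
rewrite (perm_big _ (perm_to_rem as_)) big_cons /rearr_sum big_ord_recr /= addrC.
apply: lerD; last exact: rearr_ge_last bx us sn ha.
by apply: IH; rewrite ?rem_uniq // size_rem // sn.
Qed.

Lemma rearr_approx x n (e : R) : bounded_seq x -> 0 < e ->
  exists s : seq nat, [/\ uniq s, size s = n &
    rearr_sum x n <= \sum_(k <- s) rnorm (x k) + e *+ n].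
Proof.
move=> bx e0; elim: n => [|n [s [us sn IH]]].
  by exists [::]; split; rewrite // /rearr_sum big_ord0 big_nil mulr0n addr0.
suff [k [ks hk]] : exists k, k \notin s /\ rearr x n <= rnorm (x k) + e.
  exists (k :: s); split; rewrite /= ?ks ?sn //.
  rewrite /rearr_sum big_ord_recr /= big_cons mulrS addrACA addrC.
  exact: lerD.
have [t0|t0] := leP 0 (rearr x n - e); last first.
  exists (\max_(i <- s) i).+1; split.
    by apply/negP => /(@leq_bigmax_seq nat s xpredT (fun i => i)) /(_ isT); rewrite ltnn.
  by rewrite -lerBlDr (le_trans (ltW t0)) ?rnorm_ge0.
apply: contrapT => /forallNP H.
have : rearr x n <= rearr x n - e.
  apply: ge_inf; first by exists 0; exact: rearr_lb.
  split => //; apply: (@card_le_trans _ _ _ [set` s]).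
    apply: subset_card_le => k /= hk; apply: contrapT => /negP ks.
    by apply: (H k); split => //; rewrite -lerBlDr ltW.
  by have := card_set_seq us; rewrite card_eq_le sn => /andP[].
by rewrite lerBrDr gerDl leNgt e0.
Qed.

Lemma bounded_seqD x y : bounded_seq x -> bounded_seq y -> bounded_seq (x + y).
Proof.
move=> [M xM] [N yN]; exists (M + N) => k.
exact: le_trans (rnormD _ _) (lerD (xM k) (yN k)).
Qed.

Lemma bounded_seqZ (a : R[i]) x : bounded_seq x -> bounded_seq (a *: x).
Proof.
move=> [M xM]; exists (rnorm a * M) => k.
by rewrite [(_ *: _) k]/(a * x k) rnormM ler_wpM2l ?rnorm_ge0.
Qed.

Lemma rearr_le n (a b : R) : (forall e, 0 < e -> a <= b + e *+ n) -> a <= b.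
Proof.
move=> H; apply/ler_addgt0Pr => e e0.
have := H (e / n.+1%:R) (divr_gt0 e0 (ltr0Sn _ _)).
move=> /le_trans; apply; rewrite lerD2l -[leLHS]mulr_natr -mulrA ler_piMr ?(ltW e0) //.
by rewrite mulrC ler_pdivrMr ?ltr0Sn // mul1r ler_nat.
Qed.

Lemma rearr_sumD x y n : bounded_seq x -> bounded_seq y ->
  rearr_sum (x + y) n <= rearr_sum x n + rearr_sum y n.
Proof.
move=> bx by_; apply: (@rearr_le n) => e e0.
have [s [us <- /le_trans]] := rearr_approx n (bounded_seqD bx by_) e0; apply.
rewrite lerD2r (le_trans _ (lerD (sum_le_rearr bx us) (sum_le_rearr by_ us))) //.
by rewrite -big_split /=; apply: ler_sum => k _; exact: rnormD.
Qed.

Lemma rearr_sumZ_le (a : R[i]) x n : bounded_seq x ->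
  rearr_sum (a *: x) n <= rnorm a * rearr_sum x n.
Proof.
move=> bx; apply: (@rearr_le n) => e e0.
have [s [us <- /le_trans]] := rearr_approx n (bounded_seqZ a bx) e0; apply.
rewrite lerD2r (le_trans _ (ler_wpM2l (rnorm_ge0 a) (sum_le_rearr bx us))) //.
by rewrite mulr_sumr; apply: ler_sum => k _; rewrite -rnormM.
Qed.

Lemma rearr_sumZ (a : R[i]) x n : bounded_seq x ->
  rearr_sum (a *: x) n = rnorm a * rearr_sum x n.
Proof.
move=> bx; apply/eqP; rewrite eq_le rearr_sumZ_le //=.
have [->|a0] := eqVneq a 0.
  by rewrite rnorm0 mul0r rearr_sum_ge0 //; exact: bounded_seqZ.
have := rearr_sumZ_le a^-1 n (bounded_seqZ a bx).
rewrite scalerA mulVf // scale1r => /(ler_wpM2l (rnorm_ge0 a)).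
by rewrite mulrA -rnormM mulfV // /rnorm normr1 mul1r.
Qed.

Lemma rearr0_ge x k : bounded_seq x -> rnorm (x k) <= rearr x 0.
Proof.
by move=> bx; apply: (@rearr_ge_last x [:: k]) => // j; rewrite inE => /eqP ->.
Qed.

End Rearrangement.

Section DStar.
Context {R : realType} (w : admissible_seq R).

Definition dstar_set : set (nat -> R[i]) :=
  [set x | bounded_seq x /\
           (fun n => rearr_sum x n / Wsum w n) @ \oo --> (0 : R)].

Definition dstar_pred : {pred nat -> R[i]} := mem dstar_set.

(* The carrier of $d_*(w,1)$. *)
Record dstar := DStar {
  dstar_val :> nat -> R[i] ;
  _ : dstar_val \in dstar_pred }.

HB.instance Definition _ := [isSub for dstar_val].
HB.instance Definition _ := [Choice of dstar by <:].

Lemma Wsum_ge0 n : 0 <= Wsum w n.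
Proof. by apply: sumr_ge0 => i _; exact: admissible_ge0. Qed.

Lemma Wsum_gt0 n : 0 < Wsum w n.+1.
Proof.
rewrite /Wsum big_ord_recl /= admissible_w1 ltr_pwDl ?ltr01 //.
by apply: sumr_ge0 => i _; exact: admissible_ge0.
Qed.

Lemma dstar_submod_closed : submod_closed dstar_pred.
Proof.
have key (a : R[i]) x y : dstar_set x -> dstar_set y -> dstar_set (a *: x + y).
  move=> [bx cx] [by_ cy].
  have bax := bounded_seqZ a bx.
  split; first exact: bounded_seqD.
  apply: (@squeeze_cvgr _ _ _ _ (fun=> 0)
    (fun n => rnorm a * (rearr_sum x n / Wsum w n) + rearr_sum y n / Wsum w n)).
  - near=> n; rewrite divr_ge0 ?Wsum_ge0 ?rearr_sum_ge0 //=; last first.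
      exact: bounded_seqD.
    rewrite mulrA -mulrDl ler_wpM2r ?invr_ge0 ?Wsum_ge0 //.
    by rewrite -rearr_sumZ //; exact: rearr_sumD.
  - exact: cvg_cst.
  - rewrite -[X in _ --> X]addr0 -[X in _ --> X + _](mulr0 (rnorm a)).
    by apply: cvgD => //; apply: cvgMr.
split=> [|a x y].
  rewrite inE; have b0 : bounded_seq (0 : nat -> R[i]).
    by exists 0 => k; rewrite rnorm0.
  split=> //; rewrite (_ : (fun _ => _) = fun=> 0); first exact: cvg_cst.
  apply/funext => n.
  by rewrite -[X in rearr_sum X](scale0r (0 : nat -> R[i])) rearr_sumZ // rnorm0 !mul0r.
by rewrite !inE; exact: key.
Unshelve. all: by end_near. Qed.

HB.instance Definition _ := GRing.isSubmodClosed.Build _ _ dstar_pred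
  dstar_submod_closed.
HB.instance Definition _ := [SubChoice_isSubLmodule of dstar by <:].

(* $\|x\|_W = \sup_{n \ge 1} (\sum_{i=1}^n x^*(i)) / W(n)$. *)
Definition dstar_norm (x : dstar) : R :=
  sup (range (fun n => rearr_sum x n.+1 / Wsum w n.+1)).

Lemma dstarP (x : dstar) : dstar_set x.
Proof. by case: x => x /= /set_mem. Qed.

Lemma dstar_bounded (x : dstar) : bounded_seq x.
Proof. by have [] := dstarP x. Qed.

Lemma dstar_has_sup (x : dstar) :
  has_sup (range (fun n => rearr_sum x n.+1 / Wsum w n.+1)).
Proof.
split; first by eexists; exists 0%N.
have [_ cx] := dstarP x.
have /cvg_seq_bounded[M [_ HM]] := cvgP _ cx.
exists (M + 1) => _ [n _ <-].
exact: le_trans (ler_norm _) (HM (M + 1) (ltr_pwDr ltr01 (lexx _)) n.+1 I).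
Qed.

Lemma dstar_norm_ge (x : dstar) n :
  rearr_sum x n.+1 / Wsum w n.+1 <= dstar_norm x.
Proof. by apply: sup_ubound; [case: (dstar_has_sup x)|exists n]. Qed.

Lemma dstar_norm_le (x : dstar) M :
  (forall n, rearr_sum x n.+1 / Wsum w n.+1 <= M) -> dstar_norm x <= M.
Proof.
by move=> H; apply: ge_sup; [case: (dstar_has_sup x)|move=> _ [n _ <-]].
Qed.

Lemma dstar_norm_ge0 (x : dstar) : 0 <= dstar_norm x.
Proof.
apply: le_trans (dstar_norm_ge x 0).
by rewrite divr_ge0 ?Wsum_ge0 ?rearr_sum_ge0 //; exact: dstar_bounded.
Qed.

Definition dstar_cnorm (x : dstar) : R[i] := (dstar_norm x)%:C.

Lemma dstar_cnormD x y : dstar_cnorm (x + y) <= dstar_cnorm x + dstar_cnorm y.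
Proof.
rewrite /dstar_cnorm -rmorphD lecR; apply: dstar_norm_le => n.
apply: le_trans (lerD (dstar_norm_ge x n) (dstar_norm_ge y n)).
rewrite -mulrDl ler_wpM2r ?invr_ge0 ?Wsum_ge0 //.
by apply: rearr_sumD; exact: dstar_bounded.
Qed.

Lemma dstar_cnormZ (a : R[i]) x : dstar_cnorm (a *: x) = `|a| * dstar_cnorm x.
Proof.
rewrite /dstar_cnorm -rnormE -rmorphM; congr (_ %:C).
have le_ (b : R[i]) y : dstar_norm (b *: y) <= rnorm b * dstar_norm y.
  apply: dstar_norm_le => n.
  rewrite [X in rearr_sum X](_ : _ = b *: (y : nat -> R[i])) //.
  rewrite rearr_sumZ; last exact: dstar_bounded.
  by rewrite -mulrA ler_wpM2l ?rnorm_ge0 ?dstar_norm_ge.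
apply/eqP; rewrite eq_le le_ /=; have [->|a0] := eqVneq a 0.
  by rewrite rnorm0 mul0r dstar_norm_ge0.
have := le_ a^-1 (a *: x).
rewrite scalerA mulVf // scale1r => /(ler_wpM2l (rnorm_ge0 a)).
by rewrite mulrA -rnormM mulfV // /rnorm normr1 mul1r.
Qed.

Lemma dstar_cnorm0_eq0 x : dstar_cnorm x = 0 -> x = 0.
Proof.
move=> /(@complexI R _ 0) x0; apply/val_inj/funext => k /=.
apply: rnorm_eq0; apply/eqP; rewrite eq_le rnorm_ge0 andbT -x0.
apply: le_trans (dstar_norm_ge x 0).
rewrite /rearr_sum /Wsum !big_ord1 admissible_w1 divr1.
by apply: rearr0_ge; exact: dstar_bounded.
Qed.

HB.instance Definition _ := Lmodule_isNormed.Build R[i] dstar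
  dstar_cnormD dstar_cnormZ dstar_cnorm0_eq0.

End DStar.

Section BanachSpaceNotions.
Context {R : realType}.

Definition strictly_convex (Y : normedModType R[i]) : Prop :=
  forall x y : Y, rnorm x = 1 -> rnorm y = 1 -> x != y ->
    rnorm (2^-1 *: (x + y)) < 1.

(* A(v_1, ..., v_N) linear in each variable; dfwith v u is v with its i-th
   entry replaced by u. *)
Definition multilinear (N : nat) (X Y : normedModType R[i])
    (A : ('I_N -> X) -> Y) : Prop :=
  forall (v : 'I_N -> X) (i : 'I_N),
    linear (fun u : X => A (@dfwith 'I_N (fun=> X) v i u)).

Definition continuous_homog_poly (N : nat) (X Y : normedModType R[i])
    (Q : X -> Y) : Prop :=
  (exists2 A : ('I_N -> X) -> Y, multilinear A & forall x, Q x = A (fun=> x))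
  /\ continuous Q.

(* Elements of $\mathcal{A}_u(X;Y)$ are represented by functions defined on
   the whole of X, of which only the restriction to $B_X$ matters.  Holomorphic
   means complex Frechet differentiable: differentiability is over R[i]. *)
Definition A_u (X Y : normedModType R[i]) (f : X -> Y) : Prop :=
  (forall e : R, 0 < e -> exists2 d : R, 0 < d &
     forall x y : X, rnorm x <= 1 -> rnorm y <= 1 ->
       rnorm (x - y) < d -> rnorm (f x - f y) < e)
  /\ (forall x : X, rnorm x < 1 -> differentiable f x).

(* The norm of $\mathcal{A}_u(X;Y)$ is the case s = 1.  The real sup is never
   taken of an unbounded set for s <= 1: uniformly continuous functions on
   $B_X$ and continuous polynomials are bounded there. *)
Definition norm_s (X Y : normedModType R[i]) (s : R) (f : X -> Y) : R :=
  sup [set rnorm (f x) | x in [set x : X | rnorm x <= s]].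

Definition attains_norm_s (X Y : normedModType R[i]) (s : R) (f : X -> Y) :
    Prop :=
  exists2 x0 : X, rnorm x0 <= s & rnorm (f x0) = norm_s s f.

Definition approximable (X Y : normedModType R[i]) (s0 : R)
    (F : set (X -> Y)) (Q : X -> Y) : Prop :=
  forall e : R, 0 < e -> exists2 f : X -> Y, F f & norm_s s0 (Q - f) < e.

End BanachSpaceNotions.

(* Main.v *)
(**
Fix v <> 0 in W and let Q x = (\sum_i x(i)^N) v; the sum converges because x*
is majorized by ||x|| w and w lies in l_N.  Let f in A_u attain the s-norm at
x0.  Some coordinate n leaves room at x0: ||x0 + z e_n|| <= s for small complex
z, so g(z) = f(x0 + z e_n) has ||g|| <= ||g(0)|| near 0.  Averaging g over small
circles against the weights 1 +- cos(N y) gives the points p +- c a_N of the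
ball of radius ||p||, where p = g(0) and a_N is the N-th Taylor coefficient of
g, hence a_N = 0 by strict convexity.  On the other hand the N-th coefficient
of z |-> Q(x0 + z e_n) is v, so the Cauchy estimate on a circle of radius
rho < s0 - s gives ||v|| rho^N <= ||Q - f||_{s0}.

Cauchy's theorem is needed for maps that are only complex differentiable and
take values in a Banach space.  It is proved by Goursat's bisection directly
for composite midpoint sums, which are exactly additive under bisection and
exact on affine maps, so that no vector-valued integral is required; circles
are the images of vertical segments under exp.
*)

Require Import Defs.
From HB Require Import structures.
From mathcomp Require Import all_boot all_order all_algebra.
From mathcomp Require Import all_classical all_reals all_analysis.
From mathcomp.real_closed Require Import complex.
From mathcomp Require Import ring lra.

Set Implicit Arguments.
Unset Strict Implicit.
Unset Printing Implicit Defensive.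

Import Order.TTheory GRing.Theory Num.Theory.
Import numFieldNormedType.Exports.

Local Open Scope classical_set_scope.
Local Open Scope ring_scope.
Local Open Scope complex_scope.

(** * Real-valued norms and midpoint sums *)

Section RealNorm.
Context {R : realType}.
Implicit Types (U : normedZmodType R[i]) (V : normedModType R[i]).

Lemma rnormN U (v : U) : rnorm (- v) = rnorm v.
Proof. by rewrite /rnorm normrN. Qed.

Lemma rnormBC U (u v : U) : rnorm (u - v) = rnorm (v - u).
Proof. by rewrite -rnormN opprB. Qed.

Lemma rnormB U (u v : U) : rnorm (u - v) <= rnorm u + rnorm v.
Proof. by rewrite -(rnormN v) rnormD. Qed.

Lemma rnormBB U (u v t : U) : rnorm (u - v) <= rnorm (u - t) + rnorm (t - v).
Proof. by rewrite -[u in leLHS](subrK t) -addrA rnormD. Qed.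

Lemma rnorm_real (r : R) : rnorm r%:C = `|r|.
Proof. by apply: (@complexI R); rewrite rnormE normc_def /= expr0n addr0 sqrtr_sqr. Qed.

Lemma rnormZ V (a : R[i]) (v : V) : rnorm (a *: v) = rnorm a * rnorm v.
Proof. by apply: (@complexI R); rewrite rmorphM /= !rnormE normrZ. Qed.

Lemma rnormMn U (v : U) n : rnorm (v *+ n) = rnorm v *+ n.
Proof. by rewrite /rnorm normrMn raddfMn. Qed.

Lemma rnormX (a : R[i]) n : rnorm (a ^+ n) = rnorm a ^+ n.
Proof. by apply: (@complexI R); rewrite rmorphXn /= !rnormE normrX. Qed.

Lemma rnorm1 : rnorm (1 : R[i]) = 1.
Proof. by rewrite /rnorm normr1. Qed.

Lemma rnorm_i : rnorm ('i : R[i]) = 1.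
Proof. by apply: (@complexI R); rewrite rnormE normc_def /= expr0n expr1n add0r sqrtr1. Qed.

Lemma rnorm_complex (x y : R) : rnorm (x +i* y) <= `|x| + `|y|.
Proof.
have -> : x +i* y = x%:C + 'i * y%:C by rewrite [LHS]complexE.
by apply: le_trans (rnormD _ _) _; rewrite rnormM rnorm_i mul1r !rnorm_real.
Qed.

Lemma ler_Re_rnorm (z : R[i]) : `|complex.Re z| <= rnorm z.
Proof. by rewrite -lecR rnormE normc_ge_Re. Qed.

(** A positive element of [R[i]] has zero imaginary part, so the epsilons of the library criteria
    can be taken in [R]. *)
Lemma gt0_complex (e : R[i]) : 0 < e -> exists2 r : R, 0 < r & e = r%:C.
Proof.
case: e => a b; rewrite ltcE /= => /andP[/eqP -> a0].
by exists a.
Qed.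

Lemma cvg_rnormP {T} {F : set_system T} {FF : Filter F} V (f : T -> V) (l : V) :
  f @ F --> l <-> forall e : R, 0 < e -> \forall t \near F, rnorm (f t - l) < e.
Proof.
split=> [/cvgrPdistC_lt H e e0|H].
  have /H : 0 < e%:C by rewrite ltcR.
  by apply: filterS => t; rewrite -rnormE ltcR.
apply/cvgrPdistC_lt => _ /gt0_complex[e e0 ->].
by apply: filterS (H e e0) => t; rewrite -rnormE ltcR.
Qed.

End RealNorm.

Section MidpointSums.
Context {R : realType}.

(* The composite midpoint rule with 2 ^ n subintervals, an exactly additive
   substitute for the integral of phi over [a, b]. *)
Fixpoint midsum {V : lmodType R[i]} n (phi : R -> V) (a b : R) : V :=
  if n is m.+1 then midsum m phi a ((a + b) / 2) + midsum m phi ((a + b) / 2) b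
  else (b - a)%:C *: phi ((a + b) / 2).

Lemma midsumD (V : lmodType R[i]) n (phi psi : R -> V) a b :
  midsum n (phi \+ psi) a b = midsum n phi a b + midsum n psi a b.
Proof.
elim: n a b => [|n IH] a b /=; first by rewrite scalerDr.
by rewrite !IH addrACA.
Qed.

Lemma midsumZ (V : lmodType R[i]) n (k : R[i]) (phi : R -> V) a b :
  midsum n (fun y => k *: phi y) a b = k *: midsum n phi a b.
Proof.
elim: n a b => [|n IH] a b /=; first by rewrite !scalerA mulrC.
by rewrite !IH scalerDr.
Qed.

Lemma midsumB (V : lmodType R[i]) n (phi psi : R -> V) a b :
  midsum n (fun y => phi y - psi y) a b = midsum n phi a b - midsum n psi a b.
Proof.
rewrite -scaleN1r -midsumZ -midsumD; congr midsum.
by apply/funext => y /=; rewrite scaleN1r.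
Qed.

Lemma midsum_cst (V : lmodType R[i]) n (v : V) a b :
  midsum n (fun=> v) a b = (b - a)%:C *: v.
Proof.
elim: n a b => [//|n IH] a b /=.
by rewrite !IH -scalerDl -rmorphD /=; congr (_%:C *: _); ring.
Qed.

(** The midpoint rule is exact here because (b - a) (a + b) / 2 = (b^2 - a^2) / 2, and these
    differences telescope under bisection. *)
Lemma midsum_id (V : lmodType R[i]) n (v : V) a b :
  midsum n (fun y => y%:C *: v) a b = ((b ^+ 2 - a ^+ 2) / 2)%:C *: v.
Proof.
elim: n a b => [|n IH] a b /=.
  by rewrite scalerA -rmorphM /=; congr (_%:C *: _); field.
by rewrite !IH -scalerDl -rmorphD /=; congr (_%:C *: _); field.
Qed.

(** All nodes lie in [a, b] and carry nonnegative weights. The majorant is complex-valued and enters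
    through its real part, so that it can be chosen holomorphic and its sums computed in the
    limit. *)
Lemma midsum_le (V : normedModType R[i]) n (phi : R -> V) (psi : R -> R[i]^o) a b :
  a <= b -> (forall y, a <= y <= b -> rnorm (phi y) <= complex.Re (psi y)) ->
  rnorm (midsum n phi a b) <= complex.Re (midsum n psi a b).
Proof.
elim: n a b => [|n IH] a b ab H /=.
  rewrite rnormZ rnorm_real ger0_norm ?subr_ge0 //.
  set y := (a + b) / 2.
  have -> : complex.Re ((b - a)%:C *: psi y) = (b - a) * complex.Re (psi y).
    by case: (psi y) => u v /=; rewrite mul0r subr0.
  by rewrite ler_wpM2l ?subr_ge0 // H // /y; lra.
apply: le_trans (rnormD _ _) _; rewrite raddfD /=.
by apply: lerD; (apply: IH => [|y yb]; [lra|apply: H; lra]).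
Qed.

Lemma midsum_le_cst (V : normedModType R[i]) n (phi : R -> V) (M : R) a b :
  a <= b -> (forall y, a <= y <= b -> rnorm (phi y) <= M) ->
  rnorm (midsum n phi a b) <= M * (b - a).
Proof.
move=> ab H; have := @midsum_le V n phi (fun=> M%:C) a b ab H.
rewrite midsum_cst => /le_trans; apply.
by rewrite /= mul0r subr0 mulrC.
Qed.

Lemma eq_midsum (V : lmodType R[i]) n (phi psi : R -> V) a b : a <= b ->
  (forall y, a <= y <= b -> phi y = psi y) ->
  midsum n phi a b = midsum n psi a b.
Proof.
elim: n a b => [|n IH] a b ab H /=; first by rewrite H //; lra.
by congr (_ + _); (apply: IH => [|y yb]; [lra|apply: H; lra]).
Qed.

(** After k bisections the pieces have length at most h, so on each piece the single midpoint value
    is within e of every value that the finer sum uses. This is the Cauchy estimate behind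
    [cvg_midsum]. *)
Lemma midsum_refine (V : normedModType R[i]) (phi : R -> V) (e h : R) k n a b :
  a <= b -> b - a <= h *+ 2 ^ k ->
  (forall x y, a <= x <= b -> a <= y <= b -> `|x - y| <= h ->
    rnorm (phi x - phi y) <= e) ->
  rnorm (midsum (k + n) phi a b - midsum k phi a b) <= e * (b - a).
Proof.
elim: k a b => [|k IH] a b ab.
  rewrite add0n expn0 mulr1n => bah H /=.
  rewrite -(midsum_cst n) -midsumB; apply: midsum_le_cst => // y yab.
  by apply: H => //; [lra|rewrite ler_norml; lra].
rewrite expnS mul2n -addnn mulrnDr => bah H /=.
rewrite opprD addrACA; apply: le_trans (rnormD _ _) _.
have -> : e * (b - a) = e * ((a + b) / 2 - a) + e * (b - (a + b) / 2) by field.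
have e1 : (h *+ 2 ^ k + h *+ 2 ^ k) = 2 * (h *+ 2 ^ k) by ring.
rewrite e1 in bah.
apply: lerD; apply: IH; try lra; move=> x y xab yab; apply: H; lra.
Qed.

End MidpointSums.

(** * Complex differentiability and Goursat's theorem *)

Lemma near_rnormP {R : realType} (V : normedModType R[i]) (x : V) (P : V -> Prop) :
  (\forall y \near x, P y) <->
  exists2 d : R, 0 < d & forall y, rnorm (y - x) < d -> P y.
Proof.
rewrite nbhs_normP; split=> [[_ /= /gt0_complex[d d0 ->] H]|[d d0 H]].
  exists d => // y yd; apply: H; rewrite /= -[in X in X < _]opprB normrN -rnormE ltcR //.
by exists d%:C; rewrite /= ?ltcR // => y /=; rewrite -rnormE ltcR rnormBC; exact: H.
Qed.

Lemma continuous_rnormP {R : realType} (U V : normedModType R[i]) (f : U -> V) (x : U) :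
  {for x, continuous f} <->
  forall e : R, 0 < e ->
    exists2 d : R, 0 < d & forall y, rnorm (y - x) < d -> rnorm (f y - f x) < e.
Proof.
rewrite /prop_for /continuous_at (@cvg_rnormP _ _ (nbhs x) _).
by split=> H e /H /near_rnormP.
Qed.

Section ComplexDifferentiability.
Context {R : realType}.
Implicit Types V : normedModType R[i].

(* Caratheodory's form of complex differentiability of F at z. *)
Definition cdiff V (F : R[i]^o -> V) (z : R[i]^o) : Prop :=
  exists2 phi : R[i]^o -> V, {for z, continuous phi} &
    forall w, F w = F z + (w - z) *: phi w.

Lemma cdiff_cst V (v : V) z : cdiff (fun=> v) z.
Proof. by exists (fun=> 0) => [|w]; [exact: cst_continuous|rewrite scaler0 addr0]. Qed.

Lemma cdiff_id z : cdiff (fun w => w) z.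
Proof.
exists (fun=> 1) => [|w]; first exact: cst_continuous.
by rewrite /GRing.scale /= mulr1 addrC subrK.
Qed.

Lemma cdiff_continuous V (F : R[i]^o -> V) z : cdiff F z -> {for z, continuous F}.
Proof.
move=> [phi cphi E].
have cz : {for z, continuous (fun w : R[i]^o => w - z)}.
  have ci : {for z, continuous (fun w : R[i]^o => w)} by exact: cvg_id.
  have cc : {for z, continuous (fun _ : R[i]^o => z)} by exact: cst_continuous.
  exact: cvgB ci cc.
have := cvgD (@cst_continuous R[i]^o V (F z) z) (cvgZ cz cphi).
have Fe : (fun=> F z) + (fun w => (w - z) *: phi w) = F by apply/funext => w; rewrite [RHS]E.
by rewrite /= Fe subrr scale0r addr0; apply; exact: nbhs_filter.
Qed.

Lemma cdiffD V (F G : R[i]^o -> V) z : cdiff F z -> cdiff G z ->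
  cdiff (fun w => F w + G w) z.
Proof.
move=> [f cf Ef] [g cg Eg]; exists (fun w => f w + g w); first exact: cvgD cf cg.
by move=> w; rewrite Ef Eg scalerDr addrACA.
Qed.

Lemma cdiffZ V (S : R[i]^o -> R[i]^o) (F : R[i]^o -> V) z :
  cdiff S z -> cdiff F z -> cdiff (fun w => S w *: F w) z.
Proof.
move=> [s cs Es] dF; have := dF => -[f cf Ef].
exists (fun w => s w *: F w + S z *: f w).
  exact: cvgD (cvgZ cs (cdiff_continuous dF))
    (cvgZ (@cst_continuous R[i]^o R[i]^o (S z) z) cf).
move=> w.
have -> : S w *: F w = S z *: (F z + (w - z) *: f w) + ((w - z) * s w) *: F w.
  by rewrite -Ef -scalerDl [in LHS]Es.
rewrite scalerDr -addrA; congr (_ + _).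
by rewrite scalerDr !scalerA addrC [S z * _]mulrC.
Qed.

Lemma cdiffX (S : R[i]^o -> R[i]^o) z n : cdiff S z -> cdiff (fun w => S w ^+ n : R[i]^o) z.
Proof.
move=> dS; elim: n => [|n IH]; first by under eq_fun do rewrite expr0; exact: cdiff_cst.
by under eq_fun do rewrite exprS; exact: cdiffZ.
Qed.

Lemma cdiff_comp V (S : R[i]^o -> R[i]^o) (F : R[i]^o -> V) z :
  cdiff S z -> cdiff F (S z) -> cdiff (fun w => F (S w)) z.
Proof.
move=> dS [f cf Ef]; have [s cs Es] := dS.
exists (fun w => s w *: f (S w)).
  exact: cvgZ cs (@continuous_comp _ _ _ S f z (cdiff_continuous dS) cf).
move=> w; have Sd : S w - S z = (w - z) * s w by rewrite Es addrAC subrr add0r.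
by rewrite Ef Sd -scalerA.
Qed.

Lemma cdiff_epsP V (F : R[i]^o -> V) z (D : V) :
  (forall e : R, 0 < e -> exists2 d : R, 0 < d & forall h : R[i]^o, rnorm h < d ->
    rnorm (F (z + h) - F z - h *: D) <= e * rnorm h) -> cdiff F z.
Proof.
(* The slope function is the difference quotient, completed by D at z. *)
move=> H; exists (fun w => if w == z then D else (w - z)^-1 *: (F w - F z)).
  apply/(@continuous_rnormP R R[i]^o) => e e0.
  have [d d0 Hd] := H (e / 2) (divr_gt0 e0 (ltr0Sn _ _)).
  exists d => // w wd; rewrite eqxx.
  case: eqVneq => [_|wz]; first by rewrite subrr rnorm0.
  have wz0 : w - z != 0 by rewrite subr_eq0.
  have wz1 : 0 < rnorm (w - z).
    by rewrite lt_def rnorm_ge0 andbT; apply: contra_neq wz0 => /rnorm_eq0.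
  rewrite -(ltr_pM2l wz1) -rnormZ scalerBr scalerA mulfV // scale1r.
  have := Hd (w - z) wd; rewrite addrCA subrr addr0 => /le_lt_trans; apply.
  by rewrite mulrC ltr_pM2l //; lra.
move=> w; case: eqVneq => [->|wz]; first by rewrite subrr scale0r addr0.
by rewrite scalerA mulfV ?subr_eq0 // scale1r addrC subrK.
Qed.

End ComplexDifferentiability.

(** * Contour sums over rectangles *)

Section Goursat.
Context {R : realType} {V : normedModType R[i]}.
Implicit Types F G : R[i]^o -> V.

(** Midpoint analogue of the counterclockwise contour integral over the boundary of [a, b] x [c, d],
    in the order bottom, right, top, left; the factor ['i] is dz/dy on the vertical sides. *)
Definition rectsum n F (a b c d : R) : V :=
  midsum n (fun x => F (x +i* c)) a b + 'i *: midsum n (fun y => F (b +i* y)) c d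
  - midsum n (fun x => F (x +i* d)) a b - 'i *: midsum n (fun y => F (a +i* y)) c d.

Lemma rectsumD n F G a b c d :
  rectsum n (F \+ G) a b c d = rectsum n F a b c d + rectsum n G a b c d.
Proof.
have h (p : R -> R[i]^o) u v : midsum n (fun x => (F \+ G) (p x)) u v =
    midsum n (fun x => F (p x)) u v + midsum n (fun x => G (p x)) u v.
  exact: midsumD n (fun x => F (p x)) (fun x => G (p x)) u v.
rewrite /rectsum (h (fun x => x +i* c)) (h (fun x => x +i* d)) (h (fun y => b +i* y))
  (h (fun y => a +i* y)) !scalerDr !opprD.
by rewrite [X in X + _ + _ = _]addrACA [X in X + _ = _]addrACA [LHS]addrACA.
Qed.

(** The inner edges cancel, and the outer edges split exactly because [midsum] at depth n + 1 is by
    definition the sum over the two halves at depth n. *)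
Lemma rectsum_split n F a b c d :
  let e := (a + b) / 2 in let f := (c + d) / 2 in
  rectsum n.+1 F a b c d =
    (rectsum n F a e c f + rectsum n F e b c f) +
    (rectsum n F a e f d + rectsum n F e b f d).
Proof.
(* Gluing two rectangles along a common vertical edge m; [vsplit] does the same along a horizontal
   edge. *)
have hsplit (U : zmodType) (p1 p2 q1 q2 l m r : U) :
    (p1 + p2) + r - (q1 + q2) - l = (p1 + m - q1 - l) + (p2 + r - q2 - m).
  rewrite (addrACA (p1 + m - q1)) (addrACA (p1 + m)) (addrACA p1).
  rewrite -(opprD q1) (addrC m r) (addrC (- l)) (addrA _ (- m)); congr (_ + _).
  by rewrite [RHS]addrAC [_ + (r + m)]addrA addrK.
have vsplit (U : zmodType) (p q l1 l2 m r1 r2 : U) :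
    p + (r1 + r2) - q - (l1 + l2) = (p + r1 - m - l1) + (m + r2 - q - l2).
  rewrite [RHS]addrACA -opprD; congr (_ - _).
  by rewrite -(addrA m) (addrA (p + r1 - m)) subrK !addrA.
move=> e f; rewrite /rectsum /= -/e -/f !scalerDr.
rewrite (vsplit _ _ _ _ _
  (midsum n (fun x => F (x +i* f)) a e + midsum n (fun x => F (x +i* f)) e b)).
by rewrite (hsplit _ _ _ _ _ _ ('i *: midsum n (fun y => F (e +i* y)) c f))
  (hsplit _ _ _ _ _ _ ('i *: midsum n (fun y => F (e +i* y)) f d)).
Qed.

Lemma rectsum_cst n (u : V) a b c d : rectsum n (fun=> u) a b c d = 0.
Proof. by rewrite /rectsum !midsum_cst [X in X - _]addrAC subrr add0r subrr. Qed.

(** Exactness on affine maps makes this vanish at every depth n and not only in the limit; with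
    [rectsum_cst] it removes the first-order part in Goursat's argument. *)
Lemma rectsum_scale n (D : V) a b c d : rectsum n (fun w => w *: D) a b c d = 0.
Proof.
have hor y : midsum n (fun x => (x +i* y) *: D) a b =
    (((b ^+ 2 - a ^+ 2) / 2)%:C + (b - a)%:C * (0 +i* y)) *: D.
  rewrite scalerDl -(midsum_id n) -scalerA -(midsum_cst n) -midsumD; congr midsum.
  apply/funext => x /=; rewrite -scalerDl; congr (_ *: D).
  by apply/eqP; rewrite eq_complex /= addr0 add0r !eqxx.
have ver x : midsum n (fun y => (x +i* y) *: D) c d =
    ('i * ((d ^+ 2 - c ^+ 2) / 2)%:C + (d - c)%:C * x%:C) *: D.
  rewrite scalerDl -!scalerA -(midsum_id n) -(midsum_cst n) -midsumZ -midsumD; congr midsum.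
  apply/funext => y /=; rewrite scalerA -scalerDl; congr (_ *: D).
  by apply/eqP; rewrite eq_complex /=; apply/andP; split; apply/eqP; ring.
rewrite /rectsum !hor !ver !scalerA -scalerDl -!scalerBl.
rewrite [X in X *: D](_ : _ = 0) ?scale0r //.
by apply/eqP; rewrite eq_complex /=; apply/andP; split; apply/eqP; field.
Qed.

Lemma rectsum_le n G a b c d (M : R) : a <= b -> c <= d ->
  (forall x y, a <= x <= b -> c <= y <= d -> rnorm (G (x +i* y)) <= M) ->
  rnorm (rectsum n G a b c d) <= M * ((b - a) + (d - c)) *+ 2.
Proof.
move=> ab cd H.
have hor y : c <= y <= d -> rnorm (midsum n (fun x => G (x +i* y)) a b) <= M * (b - a).
  by move=> yb; apply: midsum_le_cst => // x xb; exact: H.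
have ver x : a <= x <= b -> rnorm ('i *: midsum n (fun y => G (x +i* y)) c d) <= M * (d - c).
  by move=> xb; rewrite rnormZ rnorm_i mul1r; apply: midsum_le_cst => // y yb; exact: H.
have [aa bb] : a <= a <= b /\ a <= b <= b by rewrite !lexx ab.
have [cc dd] : c <= c <= d /\ c <= d <= d by rewrite !lexx cd.
have := hor c cc; have := hor d dd; have := ver a aa; have := ver b bb.
rewrite /rectsum; move: (midsum n (fun x => G (x +i* c)) a b) => p.
move: (midsum n (fun x => G (x +i* d)) a b) => r.
move: ('i *: midsum n (fun y => G (b +i* y)) c d) => q.
move: ('i *: midsum n (fun y => G (a +i* y)) c d) => t.
have := rnormB (p + q - r) t; have := rnormB (p + q) r; have := rnormD p q.
by move=> *; lra.
Qed.

End Goursat.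

(** * Goursat's theorem by bisection *)

Section GoursatTheorem.
Context {R : realType} {V : normedModType R[i]}.

(** Every left endpoint lies below every right endpoint, so the supremum of the left endpoints
    belongs to all the intervals. *)
Lemma nested_halving (a : nat -> R) (h : R) :
  (forall k, a k <= a k.+1 /\ a k.+1 + h / 2 ^+ k.+1 <= a k + h / 2 ^+ k) ->
  0 <= h -> exists x, forall k, a k <= x <= a k + h / 2 ^+ k.
Proof.
move=> H h0.
have /nondecreasing_seqP a_nd : forall k, a k <= a k.+1 by move=> k; case: (H k).
have /nonincreasing_seqP b_ni : forall k, a k.+1 + h / 2 ^+ k.+1 <= a k + h / 2 ^+ k.
  by move=> k; case: (H k).
have ab j k : a j <= a k + h / 2 ^+ k.
  apply: le_trans (a_nd _ _ (leq_maxl j k)) (le_trans _ (b_ni _ _ (leq_maxr j k))).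
  by rewrite lerDl divr_ge0 // exprn_ge0.
exists (sup (range a)) => k; apply/andP; split.
  apply: ub_le_sup; last by exists k.
  by exists (a 0%N + h / 2 ^+ 0) => _ [j _ <-].
by apply: ge_sup => [|_ [j _ <-] //]; exists (a 0%N), 0%N.
Qed.

Lemma exists_lt_expr2 (t : R) : exists k, t < 2 ^+ k.
Proof.
exists (Num.truncn t).+1; apply: lt_le_trans (truncnS_gt _) _.
by rewrite -natrX ler_nat ltnW // ltn_expl.
Qed.

(** If the sums do not become smaller than e, some quarter fails the bound e / 4, and so on. At the
    common point of the nested rectangles the first-order part of F contributes nothing, and the
    remainder is o(diameter) times the perimeter, which contradicts failure at a deep level. *)
Lemma goursat (F : R[i]^o -> V) (a b c d : R) : a <= b -> c <= d ->
  (forall x y, a <= x <= b -> c <= y <= d -> cdiff F (x +i* y)) ->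
  rectsum n F a b c d @[n --> \oo] --> 0.
Proof.
move=> ab cd dF; apply/cvg_rnormP => e e0; apply: contrapT => Hn.
pose h := b - a; pose l := d - c.
have h0 : 0 <= h by rewrite subr_ge0.
have l0 : 0 <= l by rewrite subr_ge0.
(* Smallness is required for all large n, since convergence of the sums is what is being proved; the
   bound e / 4^k scales like the area. *)
pose good k p q := exists n0 : nat, forall n, (n0 <= n)%N ->
  rnorm (rectsum n F p (p + h / 2 ^+ k) q (q + l / 2 ^+ k)) < e / 4 ^+ k.
pose bad k p q := [/\ a <= p, p + h / 2 ^+ k <= b, c <= q, q + l / 2 ^+ k <= d
  & ~ good k p q].
have bad0 : bad 0%N a c.
  rewrite /bad /good !expr0 !divr1 /h /l !(addrC _ (_ - _)) !subrK; split=> //.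
  move=> [n0 H]; apply: Hn; exists n0 => // n /= n0n.
  by rewrite subr0; exact: H.
have halve (r : R) k : r / 2 ^+ k = r / 2 ^+ k.+1 + r / 2 ^+ k.+1.
  by rewrite exprS; field; rewrite expf_neq0.
have step k p q : bad k p q -> exists p' q', [/\ bad k.+1 p' q',
    p <= p' /\ p' + h / 2 ^+ k.+1 <= p + h / 2 ^+ k &
    q <= q' /\ q' + l / 2 ^+ k.+1 <= q + l / 2 ^+ k].
  rewrite /bad (halve h k) (halve l k).
  set h' := h / 2 ^+ k.+1; set l' := l / 2 ^+ k.+1.
  have h'0 : 0 <= h' by rewrite divr_ge0 // exprn_ge0.
  have l'0 : 0 <= l' by rewrite divr_ge0 // exprn_ge0.
  move=> [ap pb cq qd ng].
  have [g1|] := pselect (good k.+1 p q); last first.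
    by exists p, q; split; [split=> //|split|split]; lra.
  have [g2|] := pselect (good k.+1 (p + h') q); last first.
    by exists (p + h'), q; split; [split=> //|split|split]; rewrite -/h' -/l'; lra.
  have [g3|] := pselect (good k.+1 p (q + l')); last first.
    by exists p, (q + l'); split; [split=> //|split|split]; rewrite -/h' -/l'; lra.
  have [g4|] := pselect (good k.+1 (p + h') (q + l')); last first.
    by exists (p + h'), (q + l'); split; [split=> //|split|split]; rewrite -/h' -/l'; lra.
  exfalso; apply: ng.
  move: g1 g2 g3 g4 => [n1 g1] [n2 g2] [n3 g3] [n4 g4].
  (* The split into quarters consumes one level of depth, hence the successor. *)
  exists (maxn (maxn n1 n2) (maxn n3 n4)).+1 => -[//|n].
  rewrite ltnS !geq_max => /andP[/andP[nn1 nn2] /andP[nn3 nn4]].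
  rewrite rectsum_split.
  rewrite (halve h k) (halve l k) -/h' -/l'.
  have -> : (p + (p + (h' + h'))) / 2 = p + h' by field.
  have -> : (q + (q + (l' + l'))) / 2 = q + l' by field.
  rewrite (addrA p) (addrA q).
  have -> : e / 4 ^+ k = (e / 4 ^+ k.+1 + e / 4 ^+ k.+1) + (e / 4 ^+ k.+1 + e / 4 ^+ k.+1).
    by rewrite exprS; field; rewrite expf_neq0.
  apply: le_lt_trans (rnormD _ _) _; apply: ltrD;
    apply: le_lt_trans (rnormD _ _) _; apply: ltrD.
  - exact: g1.
  - exact: g2.
  - exact: g3.
  - exact: g4.
(* The choice function must be total: on states that are not bad its value is the dummy (0, 0). *)
have /choice[nx Hnx] (s : nat * (R * R)) : exists t : R * R, bad s.1 s.2.1 s.2.2 ->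
    [/\ bad s.1.+1 t.1 t.2, s.2.1 <= t.1 /\ t.1 + h / 2 ^+ s.1.+1 <= s.2.1 + h / 2 ^+ s.1 &
    s.2.2 <= t.2 /\ t.2 + l / 2 ^+ s.1.+1 <= s.2.2 + l / 2 ^+ s.1].
  have [/step[p' [q' H]]|nb] := pselect (bad s.1 s.2.1 s.2.2).
    by exists (p', q').
  by exists (0, 0).
pose s := nat_rect (fun=> R * R)%type (a, c) (fun k t => nx (k, t)).
have sbad k : bad k (s k).1 (s k).2.
  by elim: k => [//|k IH]; case: (Hnx (k, s k) IH).
have [|x Hx] := nested_halving (a := fun k => (s k).1) _ h0.
  by move=> k; case: (Hnx (k, s k) (sbad k)).
have [|y Hy] := nested_halving (a := fun k => (s k).2) _ l0.
  by move=> k; case: (Hnx (k, s k) (sbad k)).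
have [phi /(@continuous_rnormP R R[i]^o) cphi E] : cdiff F (x +i* y).
  apply: dF.
    by have := Hx 0%N; rewrite expr0 divr1 /s /= /h; lra.
  by have := Hy 0%N; rewrite expr0 divr1 /s /= /l; lra.
(* The remainder is at most (e / K) times the diameter bound (h + l) / 2^k times the perimeter 2 (h
   + l) / 2^k. The summand 1 makes K positive and the final inequality strict. *)
set z := x +i* y in cphi E; pose K := 2 * (h + l) ^+ 2 + 1.
have K0 : 0 < K by rewrite ltr_pwDr // mulr_ge0 // sqr_ge0.
have [dl dl0 Hd] := cphi (e / K) (divr_gt0 e0 K0).
have [k Hk] : exists k, (h + l) / 2 ^+ k < dl.
  have [k Hk] := exists_lt_expr2 ((h + l) / dl).
  by exists k; rewrite ltr_pdivrMr ?exprn_gt0 // mulrC -ltr_pdivrMr.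
have [_ _ _ _ ng] := sbad k; apply: ng; exists 0%N => n _.
have := Hx k; have := Hy k; move: (s k).1 (s k).2 => p q yk xk.
have p2 : 0 < 2 ^+ k :> R by rewrite exprn_gt0.
(* The first-order expansion at z is split off; contour sums vanish on its constant and linear
   parts. *)
have -> : F = (fun w => F z - z *: phi z) \+ (fun w => w *: phi z) \+
    (fun w => (w - z) *: (phi w - phi z)).
  apply/funext => w /=; rewrite E scalerBr [(w - z) *: phi z]scalerBl.
  by rewrite opprB (addrC (_ *: phi w)) !addrA [X in _ = X - _ + _]addrAC subrK addrK.
rewrite rectsumD (rectsumD _ (fun=> _)) rectsum_cst rectsum_scale !add0r.
have hl0 : 0 <= (h + l) / 2 ^+ k by apply: divr_ge0; [exact: addr_ge0|exact: ltW].
apply: (@le_lt_trans _ _ (((h + l) / 2 ^+ k * (e / K)) *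
    ((p + h / 2 ^+ k - p) + (q + l / 2 ^+ k - q)) *+ 2)).
  apply: rectsum_le; rewrite ?lerDl ?divr_ge0 ?(ltW p2) // => x' y' x'b y'b.
  have wz : rnorm (x' +i* y' - z) <= (h + l) / 2 ^+ k.
    apply: le_trans (rnorm_complex _ _) _; rewrite mulrDl.
    by apply: lerD; rewrite ler_norml; lra.
  rewrite rnormZ ler_pM ?rnorm_ge0 // ltW // Hd //.
  exact: le_lt_trans wz Hk.
rewrite !(addrC _ (_ / 2 ^+ k)) !addrK -mulrDl.
rewrite [4 ^+ k](_ : _ = 2 ^+ k * 2 ^+ k); last by rewrite -exprMn; congr (_ ^+ _); ring.
rewrite ltr_pdivlMr ?mulr_gt0 //.
rewrite (_ : _ *+ 2 * _ = e * ((K - 1) / K)); last by rewrite /K; field; rewrite ?lt0r_neq0.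
by rewrite gtr_pMr // ltr_pdivrMr // mul1r; lra.
Qed.

End GoursatTheorem.

(** * Circle means of holomorphic maps *)

Section ComplexExponential.
Context {R : realType}.

Definition cexp (z : R[i]^o) : R[i]^o :=
  (expR (complex.Re z))%:C * (cos (complex.Im z) +i* sin (complex.Im z)).

Lemma cexpD z w : cexp (z + w) = cexp z * cexp w.
Proof.
rewrite /cexp !raddfD /= expRD cosD sinD rmorphM /=.
by apply/eqP; rewrite eq_complex /=; apply/andP; split; apply/eqP; ring.
Qed.

Lemma cexp0 : cexp 0 = 1.
Proof. by rewrite /cexp /= expR0 cos0 sin0 mul1r. Qed.

Lemma rnorm_cos_sin (y : R) : rnorm (cos y +i* sin y) = 1.
Proof. by apply: (@complexI R); rewrite rnormE normc_def /= cos2Dsin2 sqrtr1. Qed.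

Lemma rnorm_cexp z : rnorm (cexp z) = expR (complex.Re z).
Proof.
by rewrite /cexp rnormM rnorm_real ger0_norm ?expR_ge0 // rnorm_cos_sin mulr1.
Qed.

Lemma cexp_neq0 z : cexp z != 0.
Proof.
apply/eqP => /(congr1 (@rnorm R R[i])); rewrite rnorm_cexp rnorm0 => /eqP.
by rewrite gt_eqF ?expR_gt0.
Qed.

Lemma cexpN z : cexp (- z) = (cexp z)^-1.
Proof.
apply: (mulfI (cexp_neq0 z)); rewrite mulfV ?cexp_neq0 //.
by rewrite -cexpD subrr cexp0.
Qed.

Lemma cexp_periodic x : cexp (x +i* (pi *+ 2)) = cexp (x +i* 0).
Proof. by rewrite /cexp /= cos2pi sin2pi cos0 sin0. Qed.

Lemma derive_at0_eps (f : R -> R) (df e : R) : is_derive (0 : R) 1 f df -> 0 < e ->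
  exists2 d : R, 0 < d & forall h, `|h| < d -> `|f h - f 0 - h * df| <= e * `|h|.
Proof.
move=> [dvf <-] e0.
have := dvf; rewrite /derivable => /cvgrPdist_lt /(_ e e0).
rewrite /dnbhs near_withinE => /nbhs_normP[d /= d0 H].
exists d => // h hd; have [->|h0] := eqVneq h 0.
  by rewrite subrr mul0r subr0 normr0 mulr0.
have := H h; rewrite /= sub0r normrN => /(_ hd h0).
rewrite /= addr0 distrC => /ltW; rewrite /GRing.scale /= mulr1.
rewrite -(ler_pM2r (_ : 0 < `|h|)) ?normr_gt0 // -normrM.
by rewrite mulrBl mulrAC mulVf // mul1r [_ * h]mulrC.
Qed.

Lemma cexp_at0 (e : R) : 0 < e -> exists2 d : R, 0 < d &
  forall h : R[i]^o, rnorm h < d -> rnorm (cexp h - 1 - h) <= e * rnorm h.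
Proof.
(* The three error terms below add up to at most 6 e' r, where r is the modulus of h. *)
move=> e0; pose e' := e / 8; have e'0 : 0 < e' by rewrite /e'; lra.
have [d1 d10 H1] := derive_at0_eps (is_derive_expR (0 : R)) e'0.
have [d2 d20 H2] := derive_at0_eps (is_derive_sin (0 : R)) e'0.
have [d3 d30 H3] := derive_at0_eps (is_derive_cos (0 : R)) e'0.
exists (Num.min (Num.min d1 d2) (Num.min d3 (Num.min 1 e'))) => [|[x y]].
  by rewrite !lt_min d10 d20 d30 ltr01.
rewrite !lt_min => /andP[/andP[h1 h2] /andP[h3 /andP[h4 h5]]].
have xh := ler_Re_rnorm (x +i* y); rewrite /= in xh.
have yh : `|y| <= rnorm (x +i* y).
  have := ler_Re_rnorm ('i * (x +i* y)); rewrite rnormM rnorm_i mul1r /=.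
  by rewrite !mul0r !mul1r sub0r normrN.
have {H1}E1 := H1 x (le_lt_trans xh h1).
have {H2}E2 := H2 y (le_lt_trans yh h2).
have {H3}E3 := H3 y (le_lt_trans yh h3).
rewrite expR0 mulr1 in E1; rewrite sin0 cos0 mulr1 subr0 in E2.
rewrite cos0 sin0 oppr0 mulr0 subr0 in E3.
(* This separates the first-order errors of exp and of (cos, sin) from the quadratic term i x y,
   which is small because |x| < e'. *)
have -> : cexp (x +i* y) - 1 - (x +i* y) =
    (expR x - 1 - x)%:C * (cos y +i* sin y) +
    (1 + x)%:C * ((cos y - 1) +i* (sin y - y)) + x%:C * (0 +i* y).
  by rewrite /cexp; apply/eqP; rewrite eq_complex /=; apply/andP; split; apply/eqP; ring.
set r := rnorm (x +i* y) in xh yh h1 h2 h3 h4 h5 *.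
have B2 := rnorm_complex (cos y - 1) (sin y - y).
have B3 := rnorm_complex 0 y; rewrite normr0 add0r in B3.
apply: le_trans (rnormD _ _) _; apply: le_trans (lerD (rnormD _ _) (lexx _)) _.
rewrite !rnormM !rnorm_real rnorm_cos_sin mulr1.
have r0 : 0 <= r := rnorm_ge0 _.
have C1 : `|1 + x| <= 2 by apply: le_trans (ler_normD _ _) _; rewrite normr1; lra.
have C2 : `|1 + x| * rnorm ((cos y - 1) +i* (sin y - y)) <= 2 * (2 * (e' * r)).
  apply: ler_pM; rewrite ?rnorm_ge0 //; apply: le_trans B2 _.
  have : e' * `|y| <= e' * r by rewrite ler_pM2l.
  by lra.
have C3 : `|x| * rnorm (0 +i* y) <= e' * r.
  apply: ler_pM; rewrite ?rnorm_ge0 //; [lra|exact: le_trans B3 _].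
have C4 : e' * `|x| <= e' * r by rewrite ler_pM2l.
have -> : e * r = 8 * (e' * r) by rewrite /e'; field.
have : 0 <= e' * r by rewrite mulr_ge0 // ltW.
by lra.
Qed.

Lemma cdiff_cexp z : cdiff cexp z.
Proof.
apply: (@cdiff_epsP R R[i]^o _ _ (cexp z)) => e e0.
have z0 : 0 < rnorm (cexp z) by rewrite rnorm_cexp expR_gt0.
have [d d0 H] := cexp_at0 (divr_gt0 e0 z0).
exists d => // h /H hd; rewrite cexpD.
have -> : cexp z * cexp h - cexp z - h *: cexp z = cexp z * (cexp h - 1 - h).
  by rewrite /GRing.scale /= !mulrBr mulr1 [h * _]mulrC.
rewrite rnormM mulrC -ler_pdivlMr //; apply: le_trans hd _.
by rewrite mulrAC.
Qed.

Lemma cdiff_cexpN z : cdiff (fun w => cexp (- w)) z.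
Proof.
apply: (@cdiff_comp _ R[i]^o (fun w => - w)); last exact: cdiff_cexp.
under eq_fun do rewrite -scaleN1r.
exact: cdiffZ (cdiff_cst _ _) (cdiff_id _).
Qed.

End ComplexExponential.

(** * Vertical sums of periodic maps *)

Section PeriodicSums.
Context {R : realType} {V : normedModType R[i]}.

(** Goursat's theorem on [a, b] x [0, l]: by periodicity the two horizontal sides cancel, which
    leaves the difference of the vertical ones. *)
Lemma midsum_periodic_cvg (F : R[i]^o -> V) (a b l : R) : a <= b -> 0 <= l ->
  (forall x y, a <= x <= b -> 0 <= y <= l -> cdiff F (x +i* y)) ->
  (forall x, a <= x <= b -> F (x +i* l) = F (x +i* 0)) ->
  midsum n (fun y => F (b +i* y)) 0 l - midsum n (fun y => F (a +i* y)) 0 l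
    @[n --> \oo] --> 0.
Proof.
move=> ab l0 dF Fl; have := goursat ab l0 dF.
move=> /cvg_rnormP H; apply/cvg_rnormP => e /H.
apply: filterS => n; rewrite !subr0 /rectsum.
rewrite (eq_midsum (phi := fun x => F (x +i* l)) (psi := fun x => F (x +i* 0)) n ab);
  last by move=> x xb; exact: Fl.
by rewrite [X in X - _]addrAC subrr add0r -scalerBr rnormZ rnorm_i mul1r.
Qed.

End PeriodicSums.

(** * Strict convexity, limits of norms, and convergence of midpoint sums *)

Section StrictConvexity.
Context {R : realType}.

(** As p is the midpoint of p + v and p - v, both must have norm exactly ||p||. Once divided by
    ||p||, two distinct such points would have a midpoint of norm less than 1, whereas p / ||p|| has
    norm 1. *)
Lemma strictly_convex_eq0 (W : normedModType R[i]) (p v : W) :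
  strictly_convex W -> rnorm (p + v) <= rnorm p -> rnorm (p - v) <= rnorm p -> v = 0.
Proof.
move=> Wsc pv pv'; set M := rnorm p in pv pv'.
have p2 : rnorm (p *+ 2) = M *+ 2 by exact: rnormMn.
have [M0|M0] := eqVneq M 0.
  have p0 : p = 0 by exact: rnorm_eq0.
  by move: pv; rewrite M0 p0 add0r => v0; apply/rnorm_eq0/le_anti; rewrite v0 rnorm_ge0.
have Mgt0 : 0 < M by rewrite lt_def M0 rnorm_ge0.
have pp : p *+ 2 = (p + v) + (p - v) by rewrite addrACA subrr addr0.
have := rnormD (p + v) (p - v); rewrite -pp p2 => H.
have e1 : rnorm (p + v) = M by lra.
have e2 : rnorm (p - v) = M by lra.
have MC : rnorm (M^-1)%:C = M^-1 by rewrite rnorm_real ger0_norm // invr_ge0 ltW.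
have [|pv1] := eqVneq ((M^-1)%:C *: (p + v)) ((M^-1)%:C *: (p - v)).
  move/(scalerI (_ : (M^-1)%:C != 0)); rewrite fmorph_eq0 invr_eq0 => /(_ M0).
  move/addrI => /eqP; rewrite -subr_eq0 opprK -mulr2n -scaler_nat scaler_eq0 pnatr_eq0 /=.
  by move/eqP.
have n1 : rnorm ((M^-1)%:C *: (p + v)) = 1 by rewrite rnormZ MC e1 mulVf.
have n2 : rnorm ((M^-1)%:C *: (p - v)) = 1 by rewrite rnormZ MC e2 mulVf.
have := Wsc _ _ n1 n2 pv1.
rewrite -scalerDr -pp -[p *+ 2]scaler_nat !scalerA mulrCA mulVf ?pnatr_eq0 // mulr1.
by rewrite rnormZ MC mulVf // ltxx.
Qed.

Lemma cvg_rnorm_le (W : normedModType R[i]) (u : nat -> W) (v : nat -> R[i]^o)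
    (l : W) (m : R[i]^o) :
  u @ \oo --> l -> v @ \oo --> m ->
  (forall n, rnorm (u n) <= complex.Re (v n)) -> rnorm l <= complex.Re m.
Proof.
move=> /cvg_rnormP ul /(@cvg_rnormP _ _ _ _ R[i]^o) vm H; apply/ler_addgt0Pr => e e0.
have e2 : 0 < e / 2 by lra.
near \oo => n.
have h1 : rnorm (u n - l) < e / 2 by near: n; exact: ul.
have h2 : rnorm (v n - m) < e / 2 by near: n; exact: vm.
have := ler_Re_rnorm (v n - m); rewrite raddfB /= ler_norml => /andP[_ h3].
have := rnormD (u n) (l - u n); rewrite addrC subrK (rnormBC l) => h4.
have := H n; lra.
Unshelve. all: by end_near. Qed.

(** Uniform continuity and [midsum_refine] make the sums Cauchy; completeness of W provides the
    limit. *)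
Lemma cvg_midsum (W : completeNormedModType R[i]) (phi : R -> W) (a b : R) : a <= b ->
  (forall e : R, 0 < e -> exists2 h : R, 0 < h &
    forall x y, `|x - y| <= h -> rnorm (phi x - phi y) <= e) ->
  cvgn (fun n => midsum n phi a b).
Proof.
move=> ab H; apply/cauchy_cvgP/cauchy_exP => _ /gt0_complex[e e0 ->].
have ba0 : 0 < b - a + 1 by lra.
have [h h0 Hh] := H (e / (b - a + 1)) (divr_gt0 e0 ba0).
have [k Hk] : exists k, b - a <= h *+ 2 ^ k.
  have [k Hk] := exists_lt_expr2 ((b - a) / h).
  by exists k; rewrite -mulr_natl natrX -ler_pdivrMr // ltW.
exists (midsum k phi a b); exists k => // n /= kn.
rewrite -ball_normE /= -rnormE ltcR rnormBC -(subnKC kn).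
apply: le_lt_trans (midsum_refine _ ab Hk _) _.
  by move=> x y _ _; exact: Hh.
by rewrite mulrAC ltr_pdivrMr // ltr_pM2l //; lra.
Qed.

End StrictConvexity.

(** * Circle sums and their dependence on the radius *)

Section CircleMeans.
Context {R : realType}.

(** For F = G o [cexp] this approximates 2 pi times the mean of G over the circle of radius exp
    b. *)
Definition circsum {V : lmodType R[i]} n (F : R[i]^o -> V) (b : R) : V :=
  midsum n (fun y => F (b +i* y)) 0 (pi *+ 2).

Let tau_ge0 : 0 <= pi *+ 2 :> R.
Proof. by rewrite mulrn_wge0 // pi_ge0. Qed.

Lemma circsum_radius (V : normedModType R[i]) (F : R[i]^o -> V) (a b : R) :
  (forall x y, Num.min a b <= x <= Num.max a b -> cdiff F (x +i* y)) ->
  (forall x, F (x +i* (pi *+ 2)) = F (x +i* 0)) ->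
  circsum n F b - circsum n F a @[n --> \oo] --> 0.
Proof.
move=> dF Fp; have [ab|/ltW ba] := leP a b.
  apply: midsum_periodic_cvg => // x y xab _; apply: dF.
  by rewrite min_l ?max_r.
apply/cvg_rnormP => e e0.
have /cvg_rnormP/(_ e e0) : circsum n F a - circsum n F b @[n --> \oo] --> 0.
  apply: midsum_periodic_cvg => // x y xab _; apply: dF.
  by rewrite min_r ?max_l.
by apply: filterS => n; rewrite !subr0 rnormBC.
Qed.

(** The sums at b are compared with those at an abscissa a where F is nearly the constant L. In the
    applications a goes to minus infinity (circles shrinking to 0) or to plus infinity. *)
Lemma circsum_cvg (V : normedModType R[i]) (F : R[i]^o -> V) (b : R) (L : V) :
  (forall x, F (x +i* (pi *+ 2)) = F (x +i* 0)) ->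
  (forall e : R, 0 < e -> exists2 a : R,
    forall x y, Num.min a b <= x <= Num.max a b -> cdiff F (x +i* y) &
    forall y, rnorm (F (a +i* y) - L) <= e) ->
  circsum n F b @[n --> \oo] --> (pi *+ 2)%:C *: L.
Proof.
move=> Fp H; apply/cvg_rnormP => e e0.
have t0 : 0 < (pi *+ 2 + 1) :> R by rewrite ltr_wpDl.
have [a dF Fa] := H (e / 2 / (pi *+ 2 + 1)) (divr_gt0 (divr_gt0 e0 (ltr0Sn _ _)) t0).
have /cvg_rnormP/(_ (e / 2) (divr_gt0 e0 (ltr0Sn _ _))) := circsum_radius dF Fp.
apply: filterS => n; rewrite subr0 => h1.
have := rnormBB (circsum n F b) ((pi *+ 2)%:C *: L) (circsum n F a).
suff : rnorm (circsum n F a - (pi *+ 2)%:C *: L) <= e / 2 by lra.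
rewrite -[X in X%:C]subr0 -(midsum_cst n) /circsum -midsumB.
apply: le_trans (midsum_le_cst _ tau_ge0 (fun y _ => Fa y)) _.
rewrite subr0 mulrAC ler_pdivrMr // ler_pM2l //; last by lra.
by rewrite lerDl.
Qed.

(** The functional equation reduces this relative estimate to the behaviour of [cexp] at 0. *)
Lemma cexp_unif (e : R) : 0 < e -> exists2 d : R, 0 < d &
  forall u v : R[i], rnorm (u - v) < d -> rnorm (cexp u - cexp v) <= e * rnorm (cexp v).
Proof.
move=> e0; have [d d0 H] := cexp_at0 (@ltr01 R).
exists (Num.min d (e / 2)) => [|u v]; first by rewrite lt_min d0; lra.
rewrite lt_min => /andP[/H h1 h2].
rewrite -[u in cexp u](subrK v) cexpD -{2}[cexp v]mul1r -mulrBl rnormM ler_wpM2r ?rnorm_ge0 //.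
by have := rnormD (cexp (u - v) - 1 - (u - v)) (u - v); rewrite subrK; lra.
Qed.

Lemma cexpMn (z : R[i]) n : cexp (z *+ n) = cexp z ^+ n.
Proof. by elim: n => [|n IH]; rewrite ?mulr0n ?cexp0 // mulrS cexpD IH exprS. Qed.

End CircleMeans.

(** * The mean value property and vanishing Taylor coefficients *)

Section CircleMeansOfHolomorphicMaps.
Context {R : realType}.

Lemma cexpN_periodic (x : R) : cexp (- (x +i* (pi *+ 2))) = cexp (- (x +i* 0)).
Proof. by rewrite !cexpN cexp_periodic. Qed.

Lemma exists_expR_lt (b d : R) : 0 < d -> exists2 a : R, a <= b & expR a < d.
Proof.
move=> d0; exists (Num.min b (ln (d / 2))); first by rewrite ge_min lexx.
apply: (@le_lt_trans _ _ (d / 2)); last by lra.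
by rewrite -[leRHS]lnK ?posrE ?divr_gt0 // ler_expR ge_min lexx orbT.
Qed.

(** Mean value property: on small circles g is close to g(0), and sums over two circles have the
    same limiting behaviour. *)
Lemma circsum_mean (V : normedModType R[i]) (g : R[i]^o -> V) (b : R) :
  (forall z, rnorm z <= expR b -> cdiff g z) ->
  circsum n (fun z => g (cexp z)) b @[n --> \oo] --> (pi *+ 2)%:C *: g 0.
Proof.
move=> dg; apply: circsum_cvg => [x|e e0]; first by rewrite cexp_periodic.
have /(@continuous_rnormP R R[i]^o)/(_ e e0)[d d0 H] : {for 0, continuous g}.
  by apply/cdiff_continuous/dg; rewrite rnorm0 expR_ge0.
have [a ab ad] := exists_expR_lt b d0.
exists a => [x y|y]; last by apply/ltW/H; rewrite subr0 rnorm_cexp.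
rewrite min_l ?max_r // => /andP[_ xb].
apply: cdiff_comp; first exact: cdiff_cexp.
by apply: dg; rewrite rnorm_cexp ler_expR.
Qed.

Lemma cexp_split (b y : R) : cexp (b +i* y) = (expR b)%:C * cexp (0 +i* y).
Proof. by rewrite /cexp /= expR0 mul1r. Qed.

Lemma cexpN_split (b y : R) : cexp (- (b +i* y)) = (expR b)^-1%:C * (cexp (0 +i* y))^*.
Proof. by rewrite /cexp /= expR0 expRN cosN sinN !mul1r. Qed.

Section StrictlyConvexValues.
Variables (W : completeNormedModType R[i]) (g : R[i]^o -> W) (b : R) (N : nat).
Hypotheses (Wsc : strictly_convex W) (N0 : (0 < N)%N).
Hypothesis dg : forall z, rnorm z <= expR b -> cdiff g z.
Hypothesis gmax : forall z, rnorm z <= expR b -> rnorm (g z) <= rnorm (g 0).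
Hypothesis gunif : forall e : R, 0 < e -> exists2 d : R, 0 < d &
  forall z w, rnorm z <= expR b -> rnorm w <= expR b ->
    rnorm (z - w) < d -> rnorm (g z - g w) < e.

(** These are the means of g(z) / z^N, which may be singular at 0, so shrinking the circle does not
    compute the limit. Its existence comes instead from uniform continuity on the circle. *)
Lemma circsum_is_cvg :
  cvgn (fun n => circsum n (fun z => cexp (- z) ^+ N *: g (cexp z)) b).
Proof.
apply: cvg_midsum => [|e e0]; first by rewrite mulrn_wge0 // pi_ge0.
(* K is the modulus of z^-N on the circle and M a positive bound for g there; each factor of the
   product gets half of e. *)
set K := (expR b)^-1 ^+ N; set M := rnorm (g 0) + 1.
have K0 : 0 < K by rewrite exprn_gt0 // invr_gt0 expR_gt0.
have M0 : 0 < M by rewrite ltr_wpDl // rnorm_ge0.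
have [d1 d10 H1] := gunif (divr_gt0 (divr_gt0 e0 (ltr0Sn _ 1)) K0).
have [d2 d20 H2] := cexp_unif (divr_gt0 (divr_gt0 d10 (ltr0Sn _ 1)) (expR_gt0 b)).
have [d3 d30 H3] := cexp_unif (divr_gt0 (divr_gt0 (divr_gt0 e0 (ltr0Sn _ 1)) K0) M0).
have N1 : 0 < N%:R + 1 :> R by rewrite ltr_wpDl.
exists (Num.min (d2 / 2) (d3 / 2 / (N%:R + 1))) => [|x y].
  by rewrite lt_min !divr_gt0.
rewrite le_min => /andP[h2 h3].
have cK u : rnorm (cexp (- (b +i* u)) ^+ N) = K.
  by rewrite rnormX rnorm_cexp /= expRN.
have cb u : rnorm (cexp (b +i* u)) = expR b by rewrite rnorm_cexp.
have xy : (b +i* x) - (b +i* y) = 0 +i* (x - y).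
  by apply/eqP; rewrite eq_complex /= subrr !eqxx.
have r_xy : rnorm ((b +i* x) - (b +i* y)) <= `|x - y|.
  by rewrite xy (le_trans (rnorm_complex _ _)) // normr0 add0r.
have g_xy : rnorm (g (cexp (b +i* x)) - g (cexp (b +i* y))) < e / 2 / K.
  apply: H1; rewrite ?cb //.
  have /H2 : rnorm ((b +i* x) - (b +i* y)) < d2 by lra.
  by rewrite cb divfK ?gt_eqF ?expR_gt0 // => /le_lt_trans; apply; lra.
have c_xy : rnorm (cexp (- (b +i* x)) ^+ N - cexp (- (b +i* y)) ^+ N) <= e / 2 / M.
  have : rnorm ((- (b +i* x)) *+ N - (- (b +i* y)) *+ N) < d3.
    rewrite -mulrnBl rnormMn -opprD rnormN.
    apply: (@le_lt_trans _ _ ((d3 / 2 / (N%:R + 1)) *+ N)).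
      by rewrite lerMn2r (le_trans r_xy h3) orbT.
    rewrite -mulr_natr mulrAC ltr_pdivrMr // ltr_pM //; lra.
  by move/H3; rewrite !cexpMn cK mulrAC divfK ?gt_eqF.
set cx := _ ^+ N in c_xy *; set cy := (X in rnorm (_ - X) <= _) in c_xy *.
have -> : cx *: g (cexp (b +i* x)) - cy *: g (cexp (b +i* y)) =
    cx *: (g (cexp (b +i* x)) - g (cexp (b +i* y))) + (cx - cy) *: g (cexp (b +i* y)).
  by rewrite scalerBr scalerBl addrA subrK.
apply: le_trans (rnormD _ _) _; rewrite !rnormZ cK.
have -> : e = K * (e / 2 / K) + (e / 2 / M) * M.
  by field; rewrite ?gt_eqF.
apply: lerD; first by rewrite ler_pM2l // ltW.
apply: ler_pM; rewrite ?rnorm_ge0 //; apply: le_trans (gmax _) _; rewrite ?cb //.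
by rewrite /M lerDl.
Qed.

(* The weights 1 + c * cos (N * y) with |c| <= 1 are nonnegative of mean 1, so
   the corresponding weighted means of g over the circle stay in the ball of
   radius ||g 0||. *)
Lemma circsum_weighted (A : W) (c : R) : `|c| <= 1 ->
  circsum n (fun z => cexp (- z) ^+ N *: g (cexp z)) b @[n --> \oo] --> A ->
  rnorm ((pi *+ 2)%:C *: g 0 + (c / 2 * expR b ^+ N)%:C *: A) <=
    rnorm ((pi *+ 2)%:C *: g 0).
Proof.
move=> c1 uA; set t : R := pi *+ 2.
have t0 : 0 <= t by rewrite mulrn_wge0 // pi_ge0.
have lim1 : circsum n (fun z => g (cexp z)) b @[n --> \oo] --> t%:C *: g 0.
  exact: circsum_mean.
have lim2 : circsum n (fun z => cexp z ^+ N *: g (cexp z)) b @[n --> \oo] --> (0 : W).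
  have := @circsum_mean W (fun z => z ^+ N *: g z) b.
  rewrite expr0n (gtn_eqF N0) scale0r scaler0; apply=> z /dg.
  exact/cdiffZ/cdiffX/cdiff_id.
have lim3 : circsum n (fun z => cexp z ^+ N : R[i]^o) 0 @[n --> \oo] --> (0 : R[i]^o).
  have := @circsum_mean R[i]^o (fun z => z ^+ N) 0.
  rewrite expr0n (gtn_eqF N0) scaler0; apply=> z _.
  exact/cdiffX/cdiff_id.
(* The real part of [al y] = exp(i N y) is cos(N y). The majorant [psi] uses [al] itself, with the
   same real part after scaling, so its sums are governed by the mean value property. *)
set M := rnorm (g 0); set al := fun y : R => cexp (0 +i* y) ^+ N.
pose phi y := (1 + c * complex.Re (al y))%:C *: g (cexp (b +i* y)).
pose psi y : R[i]^o := M%:C * (1 + c%:C * al y).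
have al1 y : `|c * complex.Re (al y)| <= 1.
  rewrite normrM mulr_ile1 //; apply: le_trans (ler_Re_rnorm _) _.
  by rewrite rnormX rnorm_cexp /= expR0 expr1n.
have phipsi n : rnorm (midsum n phi 0 t) <= complex.Re (midsum n psi 0 t).
  apply: midsum_le => // y _; rewrite /phi /psi rnormZ rnorm_real.
  have w0 : 0 <= 1 + c * complex.Re (al y).
    by have := al1 y; rewrite ler_norml; lra.
  rewrite ger0_norm // mulrC.
  have -> : complex.Re (M%:C * (1 + c%:C * al y)) = M * (1 + c * complex.Re (al y)).
    by case: (al y) => u v /=; ring.
  by rewrite ler_wpM2r // gmax // rnorm_cexp.
set k := expR b ^+ N; have k0 : k != 0 by rewrite expf_neq0 // gt_eqF ?expR_gt0.
(* On the circle, cos(N y) is half the sum of z^N / k and k z^-N, so the weighted sum splits into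
   the sums of g, z^N g and z^-N g. The middle one tends to 0 because z^N g vanishes at 0. *)
have phiE n : midsum n phi 0 t = circsum n (fun z => g (cexp z)) b +
    (c / 2 / k)%:C *: circsum n (fun z => cexp z ^+ N *: g (cexp z)) b +
    (c / 2 * k)%:C *: circsum n (fun z => cexp (- z) ^+ N *: g (cexp z)) b.
  rewrite /circsum -!midsumZ -!midsumD; congr midsum; apply/funext => y /=.
  rewrite !scalerA -[X in X + _ + _]scale1r -!scalerDl; congr (_ *: _).
  have -> : cexp (b +i* y) ^+ N = k%:C * al y.
    by rewrite cexp_split [LHS]exprMn -rmorphXn.
  have -> : cexp (- (b +i* y)) ^+ N = k^-1%:C * (al y)^*.
    by rewrite cexpN_split [LHS]exprMn -!rmorphXn /= exprVn.
  rewrite !mulrA -!rmorphM /= divfK // mulfK // -addrA -mulrDr addcJ.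
  by rewrite mulrA -(rmorph_nat (real_complex R)) -!rmorphM /= divfK ?pnatr_eq0 // -rmorphD.
have psiE n : midsum n psi 0 t =
    M%:C *: ((t%:C : R[i]^o) + c%:C *: circsum n (fun z => cexp z ^+ N : R[i]^o) 0).
  rewrite /circsum /psi (midsumZ n M%:C (fun y => (1 + c%:C * al y : R[i]^o))).
  congr (_ *: _); rewrite (midsumD n (fun=> 1 : R[i]^o)) midsum_cst subr0.
  by rewrite -midsumZ /GRing.scale /= mulr1.
have limphi : midsum n phi 0 t @[n --> \oo] -->
    t%:C *: g 0 + (c / 2 / k)%:C *: 0 + (c / 2 * k)%:C *: A.
  rewrite (funext phiE).
  have l2 := cvgZl_tmp (k := (c / 2 / k)%:C) lim2.
  have l3 := cvgZl_tmp (k := (c / 2 * k)%:C) uA.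
  exact: cvgD (cvgD lim1 (l2 _)) (l3 _).
have limpsi : midsum n psi 0 t @[n --> \oo] --> M%:C *: ((t%:C : R[i]^o) + c%:C *: (0 : R[i]^o)).
  rewrite (funext psiE).
  have l3 := cvgZl_tmp (k := c%:C) lim3.
  have l1 := @cvg_cst R[i]^o t%:C nat \oo _.
  have l4 := cvgD (l1 _) (l3 _).
  exact: (cvgZl_tmp (k := M%:C) (l4 _ _ _)).
have := cvg_rnorm_le limphi limpsi phipsi; rewrite !scaler0 !addr0 => /le_trans; apply.
by rewrite rnormZ rnorm_real ger0_norm //= mul0r subr0 mulrC.
Qed.

(** The weights for c = 1 and c = -1 place both p + v and p - v in the ball of radius ||p||, with p
    = 2 pi g(0) and v a nonzero multiple of the limit A; strict convexity gives A = 0. *)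
Lemma circsum_coef_eq0 :
  circsum n (fun z => cexp (- z) ^+ N *: g (cexp z)) b @[n --> \oo] --> (0 : W).
Proof.
have /cvg_ex[A uA] := circsum_is_cvg.
suff A0 : A = 0 by rewrite -A0.
have k0 : expR b ^+ N != 0 by rewrite expf_neq0 // gt_eqF ?expR_gt0.
have := circsum_weighted (c := 1) _ uA; rewrite normr1 => /(_ (lexx _)) h1.
have := circsum_weighted (c := -1) _ uA; rewrite normrN normr1 => /(_ (lexx _)).
rewrite !mulNr rmorphN scaleNr => h2.
have /eqP := strictly_convex_eq0 Wsc h1 h2.
rewrite scaler_eq0 fmorph_eq0 mulf_eq0 (negPf k0) orbF mulf_eq0 oner_eq0 invr_eq0 pnatr_eq0 /=.
by move/eqP.
Qed.

End StrictlyConvexValues.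

End CircleMeansOfHolomorphicMaps.

(** * A Cauchy estimate for the N-th coefficient *)

Section LeadingCoefficient.
Context {R : realType}.

(** Maximality of ||g(0)|| on the small disc kills the N-th coefficient of g, and this carries over
    to the circle of radius exp b'. The N-th coefficient of the polynomial is v, so the Cauchy
    estimate for the difference on that circle bounds ||v||. *)
Lemma leading_coef_le (W : completeNormedModType R[i]) (g : R[i]^o -> W)
    (b b' : R) (N : nat) (a : R[i]) (k v : W) (e : R) :
  strictly_convex W -> (0 < N)%N -> b <= b' ->
  (forall z, rnorm z <= expR b' -> cdiff g z) ->
  (forall z, rnorm z <= expR b -> rnorm (g z) <= rnorm (g 0)) ->
  (forall eps : R, 0 < eps -> exists2 d : R, 0 < d &
    forall z w, rnorm z <= expR b -> rnorm w <= expR b ->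
      rnorm (z - w) < d -> rnorm (g z - g w) < eps) ->
  (forall z, rnorm z <= expR b' -> rnorm (k + (a + z) ^+ N *: v - g z) <= e) ->
  rnorm v * expR b' ^+ N <= e.
Proof.
move=> Wsc N0 bb' dg gmax gunif qg.
pose G z := cexp (- z) ^+ N *: g (cexp z).
(* h(1/z) = z^-N (k + (a + z)^N v) is a polynomial in 1/z with h(0) = v, so its circle means are
   found by letting the radius tend to infinity. *)
pose h z := z ^+ N *: k + (1 + a * z) ^+ N *: v.
have dh z : cdiff h z.
  apply: cdiffD; apply: cdiffZ; try exact: cdiff_cst; apply: cdiffX.
    exact: cdiff_id.
  by apply: cdiffD (cdiff_cst _ _) (cdiffZ (cdiff_cst _ _) (cdiff_id _)).
have h0 : h 0 = v.
  by rewrite /h expr0n (gtn_eqF N0) scale0r add0r mulr0 addr0 expr1n scale1r.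
have limG : circsum n G b' @[n --> \oo] --> (0 : W).
  have dgb z : rnorm z <= expR b -> cdiff g z.
    by move=> zb; apply: dg; rewrite (le_trans zb) // ler_expR.
  have lim1 := circsum_coef_eq0 Wsc N0 dgb gmax gunif.
  have lim2 : circsum n G b' - circsum n G b @[n --> \oo] --> (0 : W).
    apply: circsum_radius => [x y|x]; last by rewrite /G cexp_periodic cexpN_periodic.
    rewrite min_l // max_r // => /andP[_ xb].
    apply: cdiffZ; first exact/cdiffX/cdiff_cexpN.
    apply: cdiff_comp; first exact: cdiff_cexp.
    by apply: dg; rewrite rnorm_cexp ler_expR.
  rewrite -[X in _ --> X]addr0.
  rewrite (_ : (fun n => _) = (fun n => (circsum n G b' - circsum n G b) + circsum n G b)).
    exact: cvgD lim2 lim1.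
  by apply/funext => n; rewrite subrK.
have limh : circsum n (fun z => h (cexp (- z))) b' @[n --> \oo] --> (pi *+ 2)%:C *: v.
  apply: circsum_cvg => [x|e1 e10]; first by rewrite cexpN_periodic.
  have /(@continuous_rnormP R R[i]^o)/(_ e1 e10)[d d0 H] := cdiff_continuous (dh 0).
  have [c cb cd] := exists_expR_lt (- b') d0.
  exists (- c) => [x y _|y].
    exact: cdiff_comp (cdiff_cexpN _) (dh _).
  by rewrite -h0; apply/ltW/H; rewrite subr0 rnorm_cexp /= opprK.
have t0 : 0 < pi *+ 2 :> R by rewrite mulrn_wgt0 // pi_gt0.
have b0 := expR_gt0 b'.
have le n : rnorm (circsum n (fun z => h (cexp (- z))) b' - circsum n G b') <=
    complex.Re ((e / expR b' ^+ N * (pi *+ 2))%:C : R[i]^o).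
  rewrite /circsum -midsumB -[X in _ * X]subr0.
  apply: midsum_le_cst => [|y _]; first exact: ltW.
  set z := b' +i* y; have -> : h (cexp (- z)) =
      cexp (- z) ^+ N *: (k + (a + cexp z) ^+ N *: v).
    rewrite scalerDr scalerA -exprMn mulrDr cexpN mulVf ?cexp_neq0 //.
    by rewrite /h [1 + _]addrC [a * _]mulrC.
  rewrite -scalerBr rnormZ rnormX rnorm_cexp /= expRN exprVn mulrC ler_pM2r ?invr_gt0 ?exprn_gt0 //.
  by apply: qg; rewrite rnorm_cexp.
have := cvg_rnorm_le (cvgB limh limG) (@cvg_cst R[i]^o _ nat \oo _) le.
rewrite subr0 rnormZ rnorm_real gtr0_norm //= mulrC ler_pM2r //.
by rewrite ler_pdivlMr ?exprn_gt0 //; apply; exact: eventually_filter.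
Qed.

End LeadingCoefficient.

(** * The space d_*(w,1) *)

Section AdmissibleWeights.
Context {R : realType} (w : admissible_seq R).
Implicit Types x : dstar w.

Lemma cvg_Wsum : Wsum w n @[n --> \oo] --> +oo.
Proof.
rewrite (_ : (fun n => _) = series w); first exact: admissible_sum.
by apply/funext => n; rewrite /series /= big_mkord.
Qed.

(** By monotonicity a zero weight would annihilate all later ones, and W(n) would stay bounded. *)
Lemma admissible_gt0 n : 0 < w n.
Proof.
rewrite lt_def admissible_ge0 andbT; apply/eqP => wn0.
have /cvgryPge/(_ (Wsum w n + 1))[m _ H] := cvg_Wsum.
have := H (m + n)%N (leq_addr _ _); rewrite /= leNgt => /negP; apply.
suff -> : Wsum w (m + n) = Wsum w n by lra.
elim: m {H} => [//|m IH]; rewrite addSn /Wsum big_ord_recr /= -/(Wsum w (m + n)) IH.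
suff -> : w (m + n)%N = 0 by rewrite addr0.
apply/le_anti; rewrite admissible_ge0 andbT -wn0.
by apply: admissible_nonincr; rewrite leq_addl.
Qed.

Lemma admissible_le1 n : w n <= 1.
Proof. by rewrite -(admissible_w1 w) admissible_nonincr. Qed.

Lemma Wsum_le n : Wsum w n <= n%:R.
Proof.
rewrite -[leRHS](@mulr_natl _ 1) mulr1 -[X in X%:R]card_ord -sumr_const.
by apply: ler_sum => i _; exact: admissible_le1.
Qed.

Lemma Wsum_recr n : Wsum w n.+1 = Wsum w n + w n.
Proof. by rewrite /Wsum big_ord_recr. Qed.

Lemma Wsum_ge1 n : 1 <= Wsum w n.+1.
Proof.
elim: n => [|n IH]; first by rewrite /Wsum big_ord1 admissible_w1.
by rewrite Wsum_recr (le_trans IH) // lerDl admissible_ge0.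
Qed.

(** Together with [rnorm_dstar_le] this describes the norm through finite sets of coordinates. *)
Lemma sum_le_dstar x (s : seq nat) : uniq s ->
  \sum_(k <- s) rnorm (x k) <= rnorm x * Wsum w (size s).
Proof.
case: s => [|k s] us; first by rewrite big_nil mulr_ge0 ?rnorm_ge0 ?Wsum_ge0.
apply: le_trans (sum_le_rearr (dstar_bounded x) us) _.
by rewrite -ler_pdivrMr ?Wsum_gt0 //; exact: dstar_norm_ge.
Qed.

Lemma rnorm_dstar_le x (M : R) :
  (forall s, uniq s -> s != [::] -> \sum_(k <- s) rnorm (x k) <= M * Wsum w (size s)) ->
  rnorm x <= M.
Proof.
move=> H; apply: dstar_norm_le => n; rewrite ler_pdivrMr ?Wsum_gt0 //.
apply: (@rearr_le _ n.+1) => e e0.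
have [s [us sn /le_trans]] := rearr_approx n.+1 (dstar_bounded x) e0; apply.
by rewrite lerD2r -sn H // -size_eq0 sn.
Qed.

Lemma coord_le_dstar x k : rnorm (x k) <= rnorm x.
Proof.
have := @sum_le_dstar x [:: k] isT.
by rewrite big_seq1 /Wsum big_ord1 admissible_w1 mulr1.
Qed.

Definition unit_seq (n k : nat) : R[i] := (k == n)%:R.

Lemma rnorm_nat (b : bool) : rnorm (b%:R : R[i]) = b%:R.
Proof. by case: b; rewrite ?rnorm1 ?rnorm0. Qed.

Lemma sum_unit_seq n (s : seq nat) : uniq s -> \sum_(k <- s) rnorm (unit_seq n k) <= 1.
Proof.
move=> us; under eq_bigr do rewrite /unit_seq rnorm_nat.
rewrite -natr_sum (eq_bigr (fun k => if k == n then 1 else 0)%N) => [|k _]; last by case: eqP.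
rewrite -big_mkcond /= sum1_count.
by rewrite count_uniq_mem // lern1 leq_b1.
Qed.

Lemma unit_seq_dstar n : unit_seq n \in dstar_pred w.
Proof.
apply/mem_set; have bu : bounded_seq (unit_seq n).
  by exists 1 => k; have := @sum_unit_seq n [:: k] isT; rewrite big_seq1.
split => //; have le1 m : rearr_sum (unit_seq n) m <= 1.
  apply: (@rearr_le _ m) => e e0.
  have [s [us sn /le_trans]] := rearr_approx m bu e0; apply.
  by rewrite lerD2r sum_unit_seq.
apply: (@squeeze_cvgr _ _ _ _ (fun=> 0) (fun m => (Wsum w m)^-1)); last 2 first.
- exact: cvg_cst.
- apply/gtr0_cvgV0; last exact: cvg_Wsum.
  by have /cvgryPgt/(_ 0) := cvg_Wsum.
near=> m; rewrite divr_ge0 ?Wsum_ge0 ?rearr_sum_ge0 //=.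
by rewrite ler_piMl ?invr_ge0 ?Wsum_ge0.
Unshelve. all: by end_near. Qed.

Definition dunit n : dstar w := DStar (unit_seq_dstar n).

Lemma rnorm_dunit n : rnorm (dunit n) = 1.
Proof.
apply/le_anti/andP; split.
  apply: rnorm_dstar_le => -[//|k s] us _; rewrite mul1r.
  exact: le_trans (sum_unit_seq n us) (Wsum_ge1 _).
by apply: le_trans (coord_le_dstar _ n); rewrite /= /unit_seq eqxx rnorm1.
Qed.

Lemma dstarD_dunit x (l : R[i]) n k :
  (x + l *: dunit n) k = x k + l * (k == n)%:R.
Proof. by []. Qed.

(** If all coordinates had modulus at least e, the first m of them would sum to at least e m >= e
    W(m), against the limit condition defining the space. *)
Lemma dstar_small_coord x (e : R) : 0 < e -> exists n, rnorm (x n) < e.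
Proof.
move=> e0; apply: contrapT => /forallNP H.
have [bx /cvgrPdist_lt/(_ e e0)[m _ Hm]] := dstarP x.
have := Hm m.+1 (leqnSn m); rewrite /= sub0r normrN ger0_norm; last first.
  by rewrite divr_ge0 ?Wsum_ge0 ?rearr_sum_ge0.
rewrite ltr_pdivrMr ?Wsum_gt0 // ltNge => /negP; apply.
apply: (@le_trans _ _ (e * m.+1%:R)); first by rewrite ler_pM2l // Wsum_le.
have := sum_le_rearr bx (iota_uniq 0 m.+1); rewrite size_iota; apply: le_trans.
rewrite -{1}[m.+1](size_iota 0) -sum1_size natr_sum mulr_sumr ler_sum // => k _.
by rewrite mulr1 leNgt; apply/negP/H.
Qed.

(** Sums over large sets of coordinates have slack, being at most (s / 2) W. Over a small set
    containing n, the n-th coordinate is so small that after the perturbation it still fits into the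
    last weight. No point of the s-ball is therefore complex extreme. *)
Lemma dstar_room x (s : R) : 0 < s -> rnorm x <= s ->
  exists n, exists2 d : R, 0 < d & forall l : R[i], rnorm l <= d ->
    rnorm (x + l *: dunit n) <= s.
Proof.
move=> s0 xs; have s2 : 0 < s / 2 by lra.
have [bx /cvgrPdist_lt/(_ _ s2)[m _ Hm]] := dstarP x.
have wm := admissible_gt0 m.
have e0 : 0 < s * w m / 2 by rewrite divr_gt0 // mulr_gt0.
have [n xn] := dstar_small_coord x e0.
(* The bound s / 2 serves sets with more than m elements, the bound s w_m / 2 the others. *)
exists n; exists (Num.min (s / 2) (s * w m / 2)) => [|l]; first by rewrite lt_min s2.
rewrite le_min => /andP[l1 l2]; apply: rnorm_dstar_le => t ut t0.
have [nt|nt] := boolP (n \in t); last first.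
  rewrite (eq_big_seq (fun k => rnorm (x k))) => [|k kt].
    by apply: le_trans (sum_le_dstar x ut) _; rewrite ler_wpM2r ?Wsum_ge0.
  rewrite dstarD_dunit; case: eqVneq kt nt => [-> ->//|_ _ _].
  by rewrite mulr0 addr0.
rewrite (perm_big _ (perm_to_rem nt)) big_cons dstarD_dunit eqxx mulr1.
have -> : \sum_(k <- rem n t) rnorm ((x + l *: dunit n) k) = \sum_(k <- rem n t) rnorm (x k).
  apply: eq_big_seq => k; rewrite mem_rem_uniq // !inE => /andP[/negPf kn _].
  by rewrite dstarD_dunit kn mulr0 addr0.
have xl := rnormD (x n) l.
case: t t0 ut nt => // k t _ ut nt.
have [mt|tm] := leqP m (size t).
  have := sum_le_rearr bx ut; rewrite (perm_big _ (perm_to_rem nt)) big_cons => h1.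
  have := Hm (size t).+1 (leqW mt); rewrite /= sub0r normrN ger0_norm; last first.
    by rewrite divr_ge0 ?Wsum_ge0 ?rearr_sum_ge0.
  rewrite ltr_pdivrMr ?Wsum_gt0 // => h2.
  have h3 : s / 2 <= s / 2 * Wsum w (size t).+1.
    by rewrite ler_peMr ?Wsum_ge1 // ltW.
  rewrite /= in h1 *; lra.
have := sum_le_dstar x (rem_uniq n ut); rewrite size_rem //= => h1.
have h2 : rnorm x * Wsum w (size t) <= s * Wsum w (size t) by rewrite ler_wpM2r ?Wsum_ge0.
have h3 : s * w m <= s * w (size t) by rewrite ler_pM2l // admissible_nonincr // ltnW.
rewrite Wsum_recr mulrDr; lra.
Qed.

End AdmissibleWeights.

(** * Power sums by majorization *)

Section PowerSums.
Context {R : realType}.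

(* Abel summation: c * \sum_(i < k) w i - \sum_(i < k) a i >= 0 is tested
   against the nonincreasing weights b. *)
Lemma ler_sum_nonincr_weight (a w b : nat -> R) (c : R) m :
  (forall i, 0 <= b i) -> (forall i, b i.+1 <= b i) ->
  (forall k, (k <= m)%N -> \sum_(i < k) a i <= c * \sum_(i < k) w i) ->
  \sum_(i < m) b i * a i <= c * \sum_(i < m) b i * w i.
Proof.
move=> b0 bS H; pose d i := c * w i - a i.
have D0 k : (k <= m)%N -> 0 <= \sum_(i < k) d i.
  by move=> /H; rewrite big_split /= sumrN -mulr_sumr subr_ge0.
suff : 0 <= \sum_(i < m) b i * d i.
  under eq_bigr do rewrite mulrBr mulrCA.
  by rewrite big_split /= sumrN -mulr_sumr subr_ge0.
apply: (@le_trans _ _ (b m * \sum_(i < m) d i)); first by rewrite mulr_ge0 ?D0.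
suff : forall k, (k <= m)%N -> b k * \sum_(i < k) d i <= \sum_(i < k) b i * d i by exact.
elim=> [|k IH] km; first by rewrite !big_ord0 mulr0.
apply: (@le_trans _ _ (b k * \sum_(i < k.+1) d i)); first by rewrite ler_wpM2r ?D0.
by rewrite !big_ord_recr /= mulrDr lerD2r IH // ltnW.
Qed.

Lemma ler_sum_expr_majorized (a w : nat -> R) (c : R) m N :
  0 <= c -> (forall i, 0 <= a i) -> (forall i, a i.+1 <= a i) ->
  (forall i, 0 <= w i) -> (forall i, w i.+1 <= w i) ->
  (forall k, (k <= m)%N -> \sum_(i < k) a i <= c * \sum_(i < k) w i) ->
  \sum_(i < m) a i ^+ N <= c ^+ N * \sum_(i < m) w i ^+ N.
Proof.
move=> c0 a0 aS w0 wS H.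
(* Factors a are traded for c w one at a time: a^p w^q is again nonincreasing, hence an admissible
   weight for Abel summation. *)
suff K p q : \sum_(i < m) a i ^+ p * w i ^+ q <= c ^+ p * \sum_(i < m) w i ^+ (p + q).
  have := K N 0%N; rewrite addn0.
  by under eq_bigr do rewrite expr0 mulr1.
elim: p q => [|p IH] q.
  by rewrite expr0 mul1r; apply: ler_sum => i _; rewrite expr0 mul1r.
under eq_bigr do rewrite exprSr mulrAC.
apply: le_trans (ler_sum_nonincr_weight (b := fun i => a i ^+ p * w i ^+ q) _ _ H) _ => [i|i|].
- by rewrite mulr_ge0 ?exprn_ge0.
- by apply: ler_pM; rewrite ?exprn_ge0 // lerXn2r ?nnegrE.
under eq_bigr do rewrite -mulrA -exprSr.
by rewrite exprS -mulrA ler_wpM2l // (le_trans (IH _)) // addnS.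
Qed.

(** Once the moduli are sorted decreasingly, their initial sums are bounded by ||x|| W(k), so they
    are majorized by ||x|| w. *)
Lemma sum_expr_dstar (w : admissible_seq R) (x : dstar w) N (s : seq nat) : uniq s ->
  \sum_(k <- s) rnorm (x k) ^+ N <= rnorm x ^+ N * \sum_(i < size s) w i ^+ N.
Proof.
move=> us; pose f k := rnorm (x k).
pose t := sort (relpre f (fun u v => v <= u)) s.
have ts : perm_eq t s by rewrite perm_sort.
have ut : uniq t by rewrite (perm_uniq ts).
(* The default 0 beyond the list keeps the sequence nonnegative and nonincreasing. *)
pose a i := nth 0 (map f t) i.
have szt : size t = size s by rewrite size_sort.
have a0 i : 0 <= a i.
  have [it|it] := ltnP i (size t); last by rewrite /a nth_default // size_map.
  by rewrite /a (nth_map 0%N) // rnorm_ge0.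
have st : sorted (fun u v => v <= u) (map f t).
  by rewrite sorted_map; apply: sort_sorted => u v; exact: le_total.
have aS i : a i.+1 <= a i.
  have [it|it] := ltnP i.+1 (size t); last by rewrite {1}/a nth_default ?size_map.
  by have /(sortedP 0)/(_ i) := st; rewrite size_map; apply.
rewrite -(perm_big _ ts) /= -szt.
have sumE (F : R -> R) k : (k <= size t)%N ->
    \sum_(j <- take k t) F (f j) = \sum_(i < k) F (a i).
  move=> kt; rewrite (big_nth 0%N) size_takel // big_mkord; apply: eq_bigr => i _.
  by rewrite nth_take // /a (nth_map 0%N) // (leq_trans (ltn_ord i)).
have := sumE (fun r => r ^+ N) (size t) (leqnn _); rewrite take_size => ->.
apply: ler_sum_expr_majorized => // [|i|i|k kt]; rewrite ?rnorm_ge0 ?admissible_ge0 //.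
  exact: admissible_nonincr.
have := @sum_le_dstar R w x _ (take_uniq k ut); rewrite size_takel //.
by rewrite (sumE id) //.
Qed.

Lemma sum_nat_expr_dstar (w : admissible_seq R) N (x : dstar w) n :
  cvgn (series (fun i => w i ^+ N)) ->
  \sum_(i < n) rnorm (x i) ^+ N <= rnorm x ^+ N * limn (series (fun i => w i ^+ N)).
Proof.
move=> cw; have := @sum_expr_dstar w x N (iota 0 n) (iota_uniq _ _).
rewrite size_iota -(big_mkord xpredT (fun i => rnorm (x i) ^+ N)) /index_iota subn0.
move=> /le_trans; apply; rewrite ler_wpM2l ?exprn_ge0 ?rnorm_ge0 //.
apply: le_trans (nondecreasing_cvgn_le _ cw n); first by rewrite /series /= big_mkord.
apply/nondecreasing_seqP => m; rewrite /series /= big_nat_recr //= lerDl.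
by rewrite exprn_ge0 ?admissible_ge0.
Qed.

Lemma lim_expr_ge0 (w : admissible_seq R) N :
  cvgn (series (fun i => w i ^+ N)) -> 0 <= limn (series (fun i => w i ^+ N)).
Proof.
move=> cw; have := sum_nat_expr_dstar (dunit w 0) 0 cw.
by rewrite rnorm_dunit expr1n mul1r big_ord0.
Qed.

End PowerSums.

(** * Absolutely summable multiples of a fixed vector *)

Section AbsolutelySummable.
Context {R : realType} (W : completeNormedModType R[i]) (v : W).
Implicit Types u : nat -> R[i].

Definition abs_bounded u (B : R) := forall n, \sum_(i < n) rnorm (u i) <= B.

Definition vsum u : W := limn (series (fun i => u i *: v)).

(** Blocks of the vector series are dominated by ||v|| times blocks of the scalar sums S, which are
    monotone and bounded. *)
Lemma vsum_cvg u B : abs_bounded u B -> series (fun i => u i *: v) @ \oo --> vsum u.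
Proof.
move=> uB; pose S n := \sum_(i < n) rnorm (u i).
have Snd : nondecreasing_seq S.
  by apply/nondecreasing_seqP => n; rewrite /S big_ord_recr /= lerDl rnorm_ge0.
have Sl : S @ \oo --> sup (range S).
  by apply: nondecreasing_cvgn => //; exists B => _ [n _ <-]; exact: uB.
have v0 : 0 < rnorm v + 1 by rewrite ltr_wpDl ?rnorm_ge0.
suff : cvgn (series (fun i => u i *: v)) by [].
apply: cauchy_cvg; apply: cauchy_exP => _ /gt0_complex[e e0 ->].
have e1 : 0 < e / 2 / (rnorm v + 1) by rewrite !divr_gt0.
move/cvgrPdist_lt : Sl => /(_ _ e1)[m _ Hm].
exists (series (fun i => u i *: v) m); exists m => // n /= mn.
rewrite -ball_normE /= -rnormE ltcR rnormBC.
have key k : rnorm (series (fun i => u i *: v) (m + k)%N - series (fun i => u i *: v) m) <=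
    (S (m + k)%N - S m) * rnorm v.
  elim: k => [|k IH]; first by rewrite addn0 !subrr rnorm0 mul0r.
  rewrite addnS /S big_ord_recr /= -/(S (m + k)%N) /series /= big_nat_recr //= addrAC.
  apply: le_trans (rnormD _ _) _.
  by rewrite -addrA (addrC (rnorm _)) addrA mulrDl rnormZ lerD2r.
have := key (n - m)%N; rewrite subnKC // => /le_lt_trans; apply.
have h1 := Hm m (leqnn m); have h2 := Hm n mn; rewrite /= in h1 h2.
have : S n - S m <= e / (rnorm v + 1).
  have -> : e / (rnorm v + 1) = e / 2 / (rnorm v + 1) + e / 2 / (rnorm v + 1).
    by field; rewrite gt_eqF.
  move: h1 h2; rewrite !ltr_norml; lra.
move=> /(ler_wpM2r (rnorm_ge0 v)) /le_lt_trans; apply.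
by rewrite mulrAC ltr_pdivrMr // ltr_pM2l // ltrDl.
Qed.

Lemma rnorm_vsum u B : abs_bounded u B -> rnorm (vsum u) <= B * rnorm v.
Proof.
move=> uB; apply: (cvg_rnorm_le (vsum_cvg uB)
  (@cvg_cst R[i]^o ((B * rnorm v)%:C : R[i]^o) nat \oo _)) => n /=.
apply: (@le_trans _ _ ((\sum_(i < n) rnorm (u i)) * rnorm v)); last first.
  by rewrite ler_wpM2r ?rnorm_ge0.
rewrite /series /= big_mkord; elim: n => [|n IH].
  by rewrite !big_ord0 rnorm0 mul0r.
rewrite !big_ord_recr /= mulrDl (le_trans (rnormD _ _)) //.
by rewrite rnormZ lerD2r.
Qed.

Lemma vsum_linear (k : R[i]) u1 u2 B1 B2 :
  abs_bounded u1 B1 -> abs_bounded u2 B2 ->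
  vsum (fun i => k * u1 i + u2 i) = k *: vsum u1 + vsum u2.
Proof.
move=> /vsum_cvg h1 /vsum_cvg h2.
have h3 := cvgD (cvgZl_tmp (k := k) h1) h2.
apply: cvg_lim => //; rewrite (_ : series _ =
  k \*: series (fun i => u1 i *: v) + series (fun i => u2 i *: v)); first exact: h3.
apply/funext => n; rewrite /series /= fctE /=.
rewrite scaler_sumr -big_split /=; apply: eq_bigr => i _.
by rewrite scalerDl scalerA.
Qed.

Lemma vsum_single n (c : R[i]) : vsum (fun i => if i == n then c else 0) = c *: v.
Proof.
apply: cvg_lim => //; apply: cvg_near_cst; exists n.+1 => // m /= nm.
rewrite /series /= (bigD1_seq n) ?mem_index_iota ?iota_uniq //= eqxx big1 ?addr0 //.
by move=> i /negPf ->; rewrite scale0r.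
Qed.

Lemma abs_bounded_single n (c : R[i]) :
  abs_bounded (fun i => if i == n then c else 0) (rnorm c).
Proof.
move=> m; have [nm|mn] := ltnP n m.
  rewrite (bigD1 (Ordinal nm)) //= eqxx big1 ?addr0 // => i.
  by rewrite -val_eqE /= => /negPf ->; rewrite rnorm0.
rewrite big1 ?rnorm_ge0 // => i _; rewrite ltn_eqF ?rnorm0 //.
exact: leq_trans (ltn_ord i) mn.
Qed.

End AbsolutelySummable.

(** * The diagonal polynomial *)

Section DiagonalForm.
Context {R : realType} (W : completeNormedModType R[i]) (v : W).
Context (w : admissible_seq R) (N : nat).
Hypotheses (N_gt0 : (0 < N)%N) (w_ellN : cvgn (series (fun i => w i ^+ N))).
Implicit Types x d : dstar w.

Let L := limn (series (fun i => w i ^+ N)).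

Definition diag_form (vs : 'I_N -> dstar w) : W :=
  vsum v (fun i => \prod_(j < N) vs j i).

Definition diag_poly x : W := vsum v (fun i => x i ^+ N).

Lemma diag_polyE x : diag_poly x = diag_form (fun=> x).
Proof.
by congr vsum; apply/funext => i; rewrite prodr_const card_ord.
Qed.

(** A crude substitute for Hölder's inequality: the product is at most the N-th power of its largest
    factor, which is one of the summands. *)
Lemma prod_le_sum_expr (a : 'I_N -> R) : (forall j, 0 <= a j) ->
  \prod_(j < N) a j <= \sum_(j < N) a j ^+ N.
Proof.
move=> a0.
case: (@Order.TotalTheory.arg_maxP _ R 'I_N (Ordinal N_gt0) xpredT a isT) => m _ H.
apply: (@le_trans _ _ (a m ^+ N)).
  rewrite -[N in X in _ <= X]card_ord -prodr_const; apply: ler_prod => j _.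
  by rewrite a0; exact: H.
by rewrite (bigD1 m) //= lerDl sumr_ge0 // => j _; rewrite exprn_ge0.
Qed.

Lemma diag_form_bounded (vs : 'I_N -> dstar w) :
  abs_bounded (fun i => \prod_(j < N) vs j i) (\sum_(j < N) rnorm (vs j) ^+ N * L).
Proof.
move=> n; apply: (@le_trans _ _ (\sum_(i < n) \sum_(j < N) rnorm (vs j i) ^+ N)).
  apply: ler_sum => i _.
  rewrite (big_morph (@rnorm R R[i]) rnormM rnorm1).
  by apply: prod_le_sum_expr => j; exact: rnorm_ge0.
rewrite exchange_big /=; apply: ler_sum => j _.
exact: sum_nat_expr_dstar.
Qed.

Lemma diag_form_multilinear : multilinear diag_form.
Proof.
move=> vs j k x y /=.
have E u i : \prod_(l < N) (@dfwith 'I_N (fun=> dstar w) vs j u l) i =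
    u i * \prod_(l < N | l != j) vs l i.
  rewrite (bigD1 j) //= dfwithin; congr (_ * _).
  by apply: eq_bigr => l lj; rewrite dfwithout // eq_sym.
rewrite /diag_form -(vsum_linear v k (diag_form_bounded _) (diag_form_bounded _)).
by congr vsum; apply/funext => i; rewrite !E mulrA -mulrDl.
Qed.

Lemma diag_poly_bounded x : abs_bounded (fun i => x i ^+ N) (rnorm x ^+ N * L).
Proof.
move=> n; under eq_bigr do rewrite rnormX; exact: sum_nat_expr_dstar.
Qed.

Lemma rnorm_diag_poly x : rnorm (diag_poly x) <= rnorm x ^+ N * L * rnorm v.
Proof. exact/rnorm_vsum/diag_poly_bounded. Qed.

Lemma rnorm_exprD_sub (a b : R[i]) (t : R) n : 0 <= t <= 1 ->
  rnorm ((a + t%:C * b) ^+ n - a ^+ n) <= t * (rnorm a + rnorm b) ^+ n.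
Proof.
move=> /andP[t0 t1]; have rt : rnorm t%:C = t by rewrite rnorm_real ger0_norm.
elim: n => [|n IH]; first by rewrite !expr0 subrr rnorm0 mulr1.
have -> : (a + t%:C * b) ^+ n.+1 - a ^+ n.+1 =
    a * ((a + t%:C * b) ^+ n - a ^+ n) + t%:C * b * (a + t%:C * b) ^+ n.
  by rewrite !exprS; ring.
apply: le_trans (rnormD _ _) _; rewrite !rnormM rt exprS mulrDl mulrDr.
apply: lerD.
  by rewrite mulrCA ler_wpM2l ?rnorm_ge0.
rewrite -mulrA ler_wpM2l // ler_wpM2l ?rnorm_ge0 // rnormX.
rewrite lerXn2r ?nnegrE ?addr_ge0 ?rnorm_ge0 //.
apply: le_trans (rnormD _ _) _; rewrite lerD2l rnormM rt.
by rewrite ler_piMl ?rnorm_ge0.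
Qed.

Lemma exprD_le (p q : R) n : 0 <= p -> 0 <= q -> (p + q) ^+ n <= 2 ^+ n * (p ^+ n + q ^+ n).
Proof.
move=> p0 q0; wlog pq : p q p0 q0 / p <= q.
  move=> H; have [pq|/ltW qp] := leP p q; first exact: H.
  by rewrite addrC [p ^+ n + _]addrC; exact: H.
apply: (@le_trans _ _ ((2 * q) ^+ n)).
  by rewrite lerXn2r ?nnegrE ?addr_ge0 ?mulr_ge0 //; lra.
by rewrite exprMn ler_wpM2l ?exprn_ge0 // lerDr exprn_ge0.
Qed.

(** Each coordinate contributes at most t (|x_i| + |y_i|)^N, and [exprD_le] separates this into N-th
    power sums of x and of y. The explicit factor t yields continuity. *)
Lemma diag_poly_sub x y (t : R) : 0 <= t <= 1 -> rnorm y <= 1 ->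
  rnorm (diag_poly (x + t%:C *: y) - diag_poly x) <=
    t * (2 ^+ N * ((rnorm x ^+ N + 1) * L)) * rnorm v.
Proof.
move=> t01 y1; have /andP[t0 t1] := t01.
have -> : diag_poly (x + t%:C *: y) - diag_poly x =
    vsum v (fun i => -1 * x i ^+ N + (x i + t%:C * y i) ^+ N).
  have B2 := diag_poly_bounded (x + t%:C *: y).
  by rewrite (vsum_linear v (-1) (diag_poly_bounded x) B2) scaleN1r addrC.
apply: rnorm_vsum => n.
have L0 : 0 <= L := lim_expr_ge0 w_ellN.
apply: (@le_trans _ _ (\sum_(i < n) t * (2 ^+ N * (rnorm (x i) ^+ N + rnorm (y i) ^+ N)))).
  apply: ler_sum => i _; rewrite mulN1r addrC.
  apply: le_trans (rnorm_exprD_sub _ _ _ t01) _.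
  by rewrite ler_wpM2l // exprD_le ?rnorm_ge0.
rewrite -mulr_sumr -mulr_sumr ler_wpM2l // ler_wpM2l ?exprn_ge0 //.
rewrite big_split /= mulrDl mul1r; apply: lerD; first exact: sum_nat_expr_dstar.
apply: le_trans (sum_nat_expr_dstar y n w_ellN) _.
by rewrite ler_piMl // exprn_ile1 ?rnorm_ge0.
Qed.

Lemma diag_poly_continuous : continuous diag_poly.
Proof.
move=> x; apply/continuous_rnormP => e e0.
set K := 2 ^+ N * ((rnorm x ^+ N + 1) * L) * rnorm v.
have K0 : 0 <= K.
  (* K is the right-hand side of that estimate at t = 1, hence bounds a norm from above. *)
  have := diag_poly_sub x (t := 1) (y := 0); rewrite ler01 lexx rnorm0 ler01 => /(_ isT isT).
  by rewrite mul1r; apply: le_trans (rnorm_ge0 _).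
have K1 : 0 < K + 1 by lra.
exists (Num.min 1 (e / (K + 1))) => [|y]; first by rewrite lt_min ltr01 divr_gt0.
rewrite lt_min => /andP[y1 y2].
set t := rnorm (y - x) in y1 y2.
have [t0|t0] := eqVneq t 0.
  by have /eqP := rnorm_eq0 t0; rewrite subr_eq0 => /eqP ->; rewrite subrr rnorm0.
have tgt0 : 0 < t by rewrite lt_def t0 rnorm_ge0.
(* The increment y - x is written as its length t times a unit vector. *)
have yE : y = x + t%:C *: ((t^-1)%:C *: (y - x)).
  by rewrite scalerA -rmorphM /= mulfV // scale1r addrC subrK.
rewrite yE; apply: le_lt_trans (diag_poly_sub _ _ _) _.
- by rewrite (ltW tgt0) (ltW y1).
- by rewrite rnormZ rnorm_real ger0_norm ?invr_ge0 ?(ltW tgt0) // mulVf.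
rewrite -mulrA -/K; move: y2; rewrite ltr_pdivlMr // => /le_lt_trans; apply.
by rewrite ler_pM2l // lerDl.
Qed.

Lemma diag_poly_homog : continuous_homog_poly N diag_poly.
Proof.
split; last exact: diag_poly_continuous.
by exists diag_form; [exact: diag_form_multilinear|exact: diag_polyE].
Qed.

(** Only the n-th term of the series changes, so along e_n the polynomial is a one-variable
    polynomial of degree N with leading coefficient v. *)
Lemma diag_poly_dunit x n (l : R[i]) :
  diag_poly (x + l *: dunit w n) = (diag_poly x - x n ^+ N *: v) + (x n + l) ^+ N *: v.
Proof.
pose c := (x n + l) ^+ N - x n ^+ N.
rewrite -addrA -scaleNr -scalerDl [- _ + _]addrC -/c [RHS]addrC -(vsum_single v n).
have := vsum_linear v 1 (abs_bounded_single n c) (diag_poly_bounded x).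
rewrite scale1r => <-.
congr vsum; apply/funext => i; rewrite dstarD_dunit mul1r.
case: eqVneq => [->|_]; first by rewrite mulr1 subrK.
by rewrite mulr0 addr0 add0r.
Qed.

End DiagonalForm.

(** * Non-approximability *)

Section UniformAlgebra.
Context {R : realType}.
Implicit Types X Y : normedModType R[i].

(** The segment from 0 to x is cut into k pieces of length less than d, and f varies by less than 1
    on each. *)
Lemma A_u_bounded X Y (f : X -> Y) : A_u f ->
  exists B : R, forall x, rnorm x <= 1 -> rnorm (f x) <= B.
Proof.
move=> [uc _]; have [d d0 H] := uc 1 ltr01.
pose k := (Num.truncn d^-1).+1.
have k0 : 0 < k%:R :> R by rewrite ltr0Sn.
have kd : k%:R^-1 < d by rewrite -[ltRHS]invrK ltf_pV2 ?posrE ?invr_gt0 ?truncnS_gt.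
exists (rnorm (f 0) + k%:R) => x x1.
pose p j : X := (j%:R / k%:R : R)%:C *: x.
have rp j : (j <= k)%N -> rnorm (p j) <= 1.
  move=> jk; rewrite rnormZ rnorm_real ger0_norm ?divr_ge0 // mulr_ile1 ?rnorm_ge0 ?divr_ge0 //.
  by rewrite ler_pdivrMr // mul1r ler_nat.
suff K j : (j <= k)%N -> rnorm (f (p j)) <= rnorm (f 0) + j%:R.
  by have := K k (leqnn k); rewrite /p divff ?gt_eqF // scale1r.
elim: j => [|j IH] jk; first by rewrite /p mul0r scale0r addr0.
have := rnormD (f (p j.+1) - f (p j)) (f (p j)); rewrite subrK => /le_trans; apply.
rewrite [in leRHS]mulrSr addrA [leLHS]addrC; apply: lerD; first by apply: IH; exact: ltnW.
apply/ltW/H; [exact: rp|exact/rp/ltnW|].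
rewrite -scalerBl -rmorphB /= -mulrBl mulrSr addrAC subrr add0r mul1r.
rewrite rnormZ rnorm_real ger0_norm ?invr_ge0 ?(ltW k0) //.
by apply: le_lt_trans kd; rewrite ler_piMr ?invr_ge0 ?(ltW k0).
Qed.

Lemma le_norm_s X Y (f : X -> Y) (s B : R) x :
  (forall y, rnorm y <= s -> rnorm (f y) <= B) -> rnorm x <= s ->
  rnorm (f x) <= norm_s s f.
Proof.
move=> H xs; apply: ub_le_sup; last by exists x.
by exists B => _ [y ys <-]; exact: H.
Qed.

Lemma differentiable_cdiff_line X Y (f : X -> Y) (x u : X) (z : R[i]^o) :
  rnorm u = 1 -> differentiable f (x + z *: u) ->
  cdiff (fun l : R[i]^o => f (x + l *: u)) z.
Proof.
move=> u1 df; apply: (@cdiff_epsP _ _ _ _ ('d f (x + z *: u) u)) => e e0.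
have /eqaddoP/(_ e%:C) := diff_locally df.
rewrite ltcR => /(_ e0)/near_rnormP[d d0 H].
exists d => // h hd; have := H (h *: u).
rewrite subr0 rnormZ u1 mulr1 => /(_ hd).
rewrite -!rnormE -rmorphM lecR /= rnormZ u1 mulr1 => /(le_trans _); apply.
rewrite [X in _ <= rnorm X](_ : _ =
  f (h *: u + (x + z *: u)) - (f (x + z *: u) + 'd f (x + z *: u) (h *: u))) //.
by rewrite ['d f _ (h *: u)]linearZ opprD addrA addrCA -scalerDl [h + z]addrC.
Qed.

End UniformAlgebra.

Lemma not_approximable_diag_poly (R : realType) (W : completeNormedModType R[i])
    (v : W) (w : admissible_seq R) (N : nat) (s s1 : R) :
  strictly_convex W -> v != 0 -> (0 < N)%N -> cvgn (series (fun i => w i ^+ N)) ->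
  0 < s -> s < s1 -> s1 <= 1 ->
  ~ approximable s1 [set f | A_u f /\ attains_norm_s s f]
      (diag_poly v N : dstar w -> W).
Proof.
move=> Wsc v0 N0 wN s0 ss1 s11 app.
(* With this radius the disc around x0 in direction e_n stays in the ball of radius s + rho < s1 <=
   1, where f is differentiable and the s1-norm controls the error. *)
set rho := (s1 - s) / 2; have rho0 : 0 < rho by rewrite /rho; lra.
have rv : 0 < rnorm v.
  by rewrite lt_def rnorm_ge0 andbT; apply: contra_neq v0 => /rnorm_eq0.
(* Half of the lower bound ||v|| rho^N that the Cauchy estimate will impose on the error. *)
have [|f [Af [x0 x0s fx0]] Qf] := app (rnorm v * rho ^+ N / 2).
  by rewrite divr_gt0 // mulr_gt0 // exprn_gt0.
have [B fB] := A_u_bounded Af.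
have [n [d d0 room]] := dstar_room s0 x0s.
have dr0 : 0 < Num.min d rho by rewrite lt_min d0.
(* Two radii are in play: exp b < d keeps the disc inside the s-ball, where ||f|| is maximal at x0,
   while rho >= exp b serves the Cauchy estimate. *)
have [b brho bd] := exists_expR_lt (ln rho) dr0.
move: bd; rewrite lt_min => /andP[bd _].
have erho : expR (ln rho) = rho by rewrite lnK // posrE.
pose u := dunit w n; have u1 : rnorm u = 1 := rnorm_dunit w n.
have line l : rnorm (x0 + l *: u) <= s + rnorm l.
  by apply: le_trans (rnormD _ _) _; rewrite rnormZ u1 mulr1 lerD2r.
have [uc hol] := Af.
have small z : rnorm z <= expR b -> rnorm (x0 + z *: u) <= s.
  by move=> zb; apply: room; lra.
have s1le : s <= 1 by lra.
have gdiff z : rnorm z <= expR (ln rho) -> cdiff (fun l : R[i]^o => f (x0 + l *: u)) z.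
  rewrite erho => zr; apply: differentiable_cdiff_line => //; apply: hol.
  by apply: le_lt_trans (line z) _; move: zr; rewrite /rho; lra.
have gmax z : rnorm z <= expR b -> rnorm (f (x0 + z *: u)) <= rnorm (f (x0 + 0 *: u)).
  move=> zb; rewrite scale0r addr0 fx0; apply: (@le_norm_s _ _ _ _ _ B).
    by move=> y ys; apply: fB; lra.
  exact: small.
have gunif eps : 0 < eps -> exists2 d : R, 0 < d &
    forall z z', rnorm z <= expR b -> rnorm z' <= expR b ->
      rnorm (z - z') < d -> rnorm (f (x0 + z *: u) - f (x0 + z' *: u)) < eps.
  move=> /uc[d' d'0 H]; exists d' => // z z' zb zb' zz'; apply: H.
  - exact: le_trans (small _ zb) s1le.
  - exact: le_trans (small _ zb') s1le.
  by rewrite opprD addrACA subrr add0r -scalerBl rnormZ u1 mulr1.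
have qg z : rnorm z <= expR (ln rho) ->
    rnorm (diag_poly v N x0 - x0 n ^+ N *: v + (x0 n + z) ^+ N *: v - f (x0 + z *: u)) <=
    rnorm v * rho ^+ N / 2.
  rewrite erho => zr; rewrite -diag_poly_dunit //; apply: le_trans (ltW Qf).
  (* The explicit bound certifies that the supremum defining [norm_s] is that of a bounded set. *)
  apply: (@le_norm_s _ _ _ (diag_poly v N - f) s1
    (limn (series (fun i => w i ^+ N)) * rnorm v + B) (x0 + z *: u)).
    move=> y ys; apply: le_trans (rnormB _ _) _; apply: lerD; last by apply: fB; lra.
    apply: le_trans (rnorm_diag_poly v wN y) _; rewrite -mulrA ler_piMl //.
      rewrite mulr_ge0 ?rnorm_ge0 //.
      exact: (lim_expr_ge0 wN).
    by rewrite exprn_ile1 ?rnorm_ge0 // (le_trans ys).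
  by apply: le_trans (line z) _; move: zr; rewrite /rho; lra.
have := leading_coef_le Wsc N0 brho gdiff gmax gunif qg.
rewrite erho => h; have : 0 < rnorm v * rho ^+ N by rewrite mulr_gt0 // exprn_gt0.
lra.
Qed.

Theorem proposition4p10 (R : realType) (W : completeNormedModType R[i])
    (W_neq0 : exists v : W, v != 0) (W_sc : strictly_convex W)
    (w : admissible_seq R) (N : nat) (N_ge2 : (2 <= N)%N)
    (w_ellN : cvgn (series (fun i => w i ^+ N)))
    (s s0 : R) (s_gt0 : 0 < s) (s_lt_s0 : s < s0) (s0_le1 : s0 <= 1) :
  exists Q : dstar w -> W,
    [/\ continuous_homog_poly N Q,
        ~ approximable s0 [set f | A_u f /\ attains_norm_s s f] Q
      & ~ approximable 1 [set f | A_u f /\ attains_norm_s s f] Q].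
Proof.
have [v v0] := W_neq0; have N0 : (0 < N)%N by exact: ltnW.
exists (diag_poly v N); split; first exact: diag_poly_homog.
  exact: not_approximable_diag_poly.
by apply: not_approximable_diag_poly => //; exact: lt_le_trans s0_le1.
Qed.
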